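(* Every $L$-formula is $S_{\overline\alpha}$-equivalent to a Boolean combination of chain-minimal extension formulas.
   Context: Fix a finite relational language $L$ in which every relation symbol has arity at least $2$. $K_L$ is the class of all finite $L$-structures (including the empty one) in which every relation symbol is interpreted symmetrically and irreflexively (if $E(\bar a)$ holds then $\bar a$ has no repetitions and $E(\pi(\bar a))$ holds for every permutation $\pi$). Fix $\overline\alpha:L\to(0,1]$, writing $\overline\alpha_E=\overline\alpha(E)$, such that it is not the case that all symbols of $L$ are binary and $\overline\alpha_E=1$ for all $E$. For $\mathfrak A\in K_L$ let $N_E(\mathfrak A)$ be the number of subsets of $A$ on which $E$ holds and $\delta(\mathfrak A)=|A|-\sum_{E\in L}\overline\alpha_E N_E(\mathfrak A)$. $K_{\overline\alpha}=\{\mathfrak A\in K_L:\delta(\mathfrak A')\ge0\text{ for all substructures }\mathfrak A'\subseteq\mathfrak A\}$. For $\mathfrak A\subseteq\mathfrak B$ in $K_L$, $\mathfrak A\le\mathfrak B$ means $\delta(\mathfrak A)\le\delta(\mathfrak A')$ for every $\mathfrak A\subseteq\mathfrak A'\subseteq\mathfrak B$. $(\mathfrak A,\mathfrak B)$ is a minimal pair if $\mathfrak A\subseteq\mathfrak B$, $\mathfrak A\le\mathfrak C$ for all $\mathfrak A\subseteq\mathfrak C\subsetneq\mathfrak B$, but $\mathfrak A\not\le\mathfrak B$. $S_{\overline\alpha}$ is the theory whose models $\mathfrak M$ are exactly those satisfying: (i) every finite substructure of $\mathfrak M$ lies in $K_{\overline\alpha}$; (ii) for all $\mathfrak A\le\mathfrak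 B$ in $K_{\overline\alpha}$, every embedding $\mathfrak A\to\mathfrak M$ extends to an embedding $\mathfrak B\to\mathfrak M$. For $\mathfrak A\subseteq\mathfrak B$ in $K_{\overline\alpha}$ with $A$ enumerated by $\bar x$ and $B\setminus A$ by $\bar y$, the extension formula is $\Psi_{\mathfrak A,\mathfrak B}(\bar x)=\Delta_{\mathfrak A}(\bar x)\wedge\exists\bar y\,\Delta_{\mathfrak A,\mathfrak B}(\bar x,\bar y)$, where $\Delta$ denotes the atomic diagram (conjunction of all atomic and negated atomic formulas true of the enumeration). It is chain-minimal if there is a chain $\mathfrak A=\mathfrak B_0\subseteq\mathfrak B_1\subseteq\dots\subseteq\mathfrak B_n=\mathfrak B$ with each $(\mathfrak B_i,\mathfrak B_{i+1})$ a minimal pair. *)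

(* Defs.v *)
From HB Require Import structures.
From mathcomp Require Import all_boot all_order all_algebra.
From mathcomp Require Import reals.

Set Implicit Arguments.
Unset Strict Implicit.
Unset Printing Implicit Defensive.

Import Order.TTheory GRing.Theory Num.Theory.
Local Open Scope ring_scope.

Section Defs.

Variables (L : finType) (ar : L -> nat).

Record Lstr := LStr {
  car :> Type;
  rel : forall E : L, ('I_(ar E) -> car) -> Prop
}.

Record finLstr := FinLstr {
  fdom : finType;
  frel : forall E : L, {ffun 'I_(ar E) -> fdom} -> bool
}.

Arguments frel : clear implicits.
Arguments rel : clear implicits.

Definition toL (B : finLstr) : Lstr :=
  @LStr (fdom B) (fun E a => frel B E (finfun a)).
Arguments toL : clear implicits.

Definition emb (A : finLstr) (M : Lstr) (f : fdom A -> car M) : Prop :=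
  injective f /\
  forall (E : L) (a : {ffun 'I_(ar E) -> fdom A}),
    frel A E a <-> rel M E (fun k => f (a k)).
Arguments emb : clear implicits.

Definition inKL (A : finLstr) : Prop :=
  forall (E : L) (a : {ffun 'I_(ar E) -> fdom A}), frel A E a ->
    injective a /\
    forall p : 'I_(ar E) -> 'I_(ar E), bijective p -> frel A E [ffun k => a (p k)].
Arguments inKL : clear implicits.

Definition holds_on (A : finLstr) (E : L) (S : {set fdom A}) : bool :=
  [exists a : {ffun 'I_(ar E) -> fdom A},
     (S == [set a k | k : 'I_(ar E)]) && frel A E a].

Arguments holds_on : clear implicits.

Definition Nset (A : finLstr) (E : L) (X : {set fdom A}) : nat :=
  #|[set S : {set fdom A} | (S \subset X) && holds_on A E S]|.

Arguments Nset : clear implicits.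

Variables (R : realType) (alpha : L -> R).

Definition deltaS (A : finLstr) (X : {set fdom A}) : R :=
  (#|X|%:R - \sum_(E : L) alpha E * (Nset A E X)%:R).
Arguments deltaS : clear implicits.

Definition delta (A : finLstr) : R := deltaS A setT.
Arguments delta : clear implicits.

Definition inKalpha (A : finLstr) : Prop :=
  inKL A /\ forall X : {set fdom A}, 0 <= deltaS A X.
Arguments inKalpha : clear implicits.

(* For substructures X ⊆ Y of A (given by their universes):  X <= Y. *)
Definition le_within (A : finLstr) (X Y : {set fdom A}) : bool :=
  [forall Z : {set fdom A},
     ((X \subset Z) && (Z \subset Y)) ==> (deltaS A X <= deltaS A Z)].
Arguments le_within : clear implicits.

Definition minpair (A : finLstr) (X Y : {set fdom A}) : bool :=
  [&& X \subset Y,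
      [forall Z : {set fdom A},
         ((X \subset Z) && (Z \proper Y)) ==> le_within A X Z]
    & ~~ le_within A X Y].
Arguments minpair : clear implicits.

Definition chain_minimal (B : finLstr) (X : {set fdom B}) : Prop :=
  exists s : seq {set fdom B}, path (minpair B) X s && (last X s == setT).
Arguments chain_minimal : clear implicits.

Definition model (M : Lstr) : Prop :=
  (forall (A : finLstr) (f : fdom A -> car M), emb A M f -> inKalpha A) /\
  (forall (A B : finLstr) (i : fdom A -> fdom B),
     emb A (toL B) i -> inKalpha A -> inKalpha B ->
     le_within B [set i a | a : fdom A] setT ->
     forall f : fdom A -> car M, emb A M f ->
       exists g : fdom B -> car M, emb B M g /\ forall a, g (i a) = f a).

Inductive form : Type :=
| FTrue : form
| FRel (E : L) (w : 'I_(ar E) -> nat) : form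
| FEq (i j : nat) : form
| FNot (f : form) : form
| FAnd (f g : form) : form
| FEx (i : nat) (f : form) : form.

Fixpoint sat (M : Lstr) (rho : nat -> car M) (f : form) {struct f} : Prop :=
  match f with
  | FTrue => True
  | FRel E w => rel M E (fun k => rho (w k))
  | FEq i j => rho i = rho j
  | FNot g => ~ sat rho g
  | FAnd g h => sat rho g /\ sat rho h
  | FEx i g => exists m : car M, sat (fun k => if k == i then m else rho k) g
  end.

Fixpoint fv (f : form) : seq nat :=
  match f with
  | FTrue => [::]
  | FRel E w => [seq w k | k <- enum 'I_(ar E)]
  | FEq i j => [:: i; j]
  | FNot g => fv g
  | FAnd g h => fv g ++ fv h
  | FEx i g => [seq k <- fv g | k != i]
  end.

Definition bigAnd (s : seq form) : form := foldr FAnd FTrue s.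
Definition exs (vs : seq nat) (f : form) : form := foldr FEx f vs.

Definition relLit (B : finLstr) (v : fdom B -> nat) (E : L)
    (a : {ffun 'I_(ar E) -> fdom B}) : form :=
  if frel B E a then FRel (fun k => v (a k)) else FNot (FRel (fun k => v (a k))).
Arguments relLit : clear implicits.

Definition eqLit (B : finLstr) (v : fdom B -> nat) (b c : fdom B) : form :=
  if b == c then FEq (v b) (v c) else FNot (FEq (v b) (v c)).
Arguments eqLit : clear implicits.

Definition diag (B : finLstr) (P : {set fdom B}) (v : fdom B -> nat) : form :=
  bigAnd (flatten [seq [seq relLit B v E a | a : {ffun 'I_(ar E) -> fdom B} <- enum {ffun 'I_(ar E) -> fdom B}
                                       & [forall k, a k \in P]]
                  | E <- enum L]
          ++ [seq eqLit B v b c | b <- enum P, c <- enum P]).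
Arguments diag : clear implicits.

(* Extension formula Psi_{A,B}(xbar), A the substructure of B on X;
   element b of B is named by the variable v b (x-variables on X,
   y-variables on B \ X, existentially quantified). *)
Definition ExtF (B : finLstr) (X : {set fdom B}) (v : fdom B -> nat) : form :=
  FAnd (diag B X v) (exs [seq v b | b <- enum (~: X)] (diag B setT v)).
Arguments ExtF : clear implicits.

Inductive boolcomb : form -> Prop :=
| bc_ext (B : finLstr) (X : {set fdom B}) (v : fdom B -> nat) :
    inKalpha B -> chain_minimal B X -> injective v -> boolcomb (ExtF B X v)
| bc_not f : boolcomb f -> boolcomb (FNot f)
| bc_and f g : boolcomb f -> boolcomb g -> boolcomb (FAnd f g).

End Defs.

(* Main.v *)
(* Quantifiers are eliminated by a finite back-and-forth.  Call a finite substructure A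
   of a model r-closed if adding at most r points never lowers delta.  Every finite set
   is contained in an r-closed one, reached by a chain of minimal pairs and of bounded
   size, so chain-minimal extension formulas of bounded size determine it up to
   isomorphism; conversely, all chain-minimal extensions of size at most r of a tuple of
   an r-closed set lie in that set.

   To match a point c of M in N, let D be an r-closed set of M containing c and the given
   parameters, and let C, with copy C' in N, be a far more closed set containing the
   parameters.  The axioms embed into N over C' any G containing the union of C and D
   with C <= G.  One chooses G so that D is r-closed in G and delta(G) - delta(C) is smaller
   than the least amount by which r points can lower delta: if D were not r-closed in N,
   then C' would not be closed either.  Such a G is obtained from the union of C and D by
   attaching to D gadgets of small negative relative delta, which exist because not all
   symbols are binary of weight 1. *)

Require Import Defs.
From HB Require Import structures.
From mathcomp Require Import all_boot all_order all_algebra.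
From mathcomp Require Import reals boolp.
From mathcomp Require Import zify ring lra.
Import Order.TTheory GRing.Theory Num.Theory.
Local Open Scope ring_scope.

Set Implicit Arguments.
Unset Strict Implicit.
Unset Printing Implicit Defensive.

(** * Embeddings of finite structures and invariance of delta under them *)

Section Basics.
Variables (L : finType) (ar : L -> nat).
Implicit Types (A B C : finLstr ar) (M N : Lstr ar).

(** The obstacle is the order of choices: [C] must be closed enough to survive the adjunction of
    [D], of the gadget points and of a hypothetical small extension, so the number of gadget points
    has to be bounded before [C] is known. Submodularity allows this: the excess of the union of [C]
    and [D] over delta of [C] is at most the size of [D], whatever [C] is, and each gadget removes a
    fixed amount of it. The size of [D] is bounded beforehand too, since among the values k - sum of
    alpha_E n_E with k bounded, the negative ones stay away from 0, so closing chains are short.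

    A gadget has to meet every point of its base, because the excess is at the disposal only of sets
    containing both [C] and the base: a set missing a base point must lose nothing. For binary edges
    of weight 1 a path-like gadget on m points has m + 1 edges, of which m - 1 join new points, so
    only two reach the base. This is where the excluded case enters. *)

Lemma emb_toLP A B (i : fdom A -> fdom B) :
  emb (M := toL B) i <->
  injective i /\ forall E a, @Defs.frel _ _ A E a = @Defs.frel _ _ B E [ffun k => i (a k)].
Proof.
split=> -[i_inj h]; split=> // E a.
  by have [h1 h2] := h E a; apply/idP/idP => /= [/h1|] //; apply: h2.
by rewrite h.
Qed.

Lemma emb_comp A B M (i : fdom A -> fdom B) (g : fdom B -> M) :
  emb (M := toL B) i -> emb g -> emb (M := M) (fun a => g (i a)).
Proof.
move=> /emb_toLP[i_inj iP] [g_inj gP]; split=> [x y /g_inj/i_inj//|E a].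
rewrite iP gP.
by under eq_fun => k do rewrite ffunE.
Qed.

Lemma emb_factor A B M (i : fdom A -> fdom B) (g : fdom B -> M) (f : fdom A -> M) :
  (forall a, g (i a) = f a) -> emb g -> emb f -> emb (M := toL B) i.
Proof.
move=> gi [g_inj gP] [f_inj fP]; apply/emb_toLP; split.
  by move=> x y ixy; apply: f_inj; rewrite -!gi ixy.
move=> E a; apply/idP/idP.
  by move=> /fP h; apply/gP; under eq_fun => k do rewrite ffunE gi.
move=> /gP h; apply/fP; move: h.
by under eq_fun => k do rewrite ffunE gi.
Qed.

Lemma emb_id A : emb (M := toL A) id.
Proof. by apply/emb_toLP; split=> // E a; congr Defs.frel; apply/ffunP => k; rewrite ffunE. Qed.

Lemma imset_codom A (E : L) (a : {ffun 'I_(ar E) -> fdom A}) B (i : fdom A -> fdom B) :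
  [set [ffun k => i (a k)] k | k : 'I_(ar E)] = i @: [set a k | k : 'I_(ar E)].
Proof. by rewrite -imset_comp; apply: eq_imset => k; rewrite /= ffunE. Qed.

Lemma holds_on_emb A B (i : fdom A -> fdom B) E (S : {set fdom A}) :
  emb (M := toL B) i -> holds_on E (i @: S) = holds_on E S.
Proof.
move=> /emb_toLP[i_inj iP]; apply/existsP/existsP => -[a /andP[/eqP Sa Ea]]; last first.
  exists [ffun k => i (a k)]; rewrite -iP Ea andbT imset_codom.
  by rewrite Sa.
have aS k : exists x, a k == i x.
  have: a k \in i @: S by rewrite Sa imset_f.
  by case/imsetP => x _ ->; exists x.
pose a' : {ffun 'I_(ar E) -> fdom A} := [ffun k => xchoose (aS k)].
have ea : [ffun k => i (a' k)] = a.
  by apply/ffunP => k; rewrite !ffunE -(eqP (xchooseP (aS k))).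
exists a'; rewrite iP ea Ea andbT; apply/eqP/(imset_inj i_inj).
by rewrite -imset_codom ea Sa.
Qed.

Lemma Nset_emb A B (i : fdom A -> fdom B) E (X : {set fdom A}) :
  emb (M := toL B) i -> Nset E (i @: X) = Nset E X.
Proof.
move=> iE; have [i_inj _] := iE.
rewrite /Nset -[RHS](card_imset _ (imset_inj i_inj)); apply: eq_card => S.
rewrite inE; apply/andP/imsetP => [[SX ES]|[S' /[!inE] /andP[S'X ES'] ->]]; last first.
  by rewrite imsetS // holds_on_emb.
have eS : S = i @: (i @^-1: S).
  apply/setP => x; apply/idP/imsetP => [xS|[y /[!inE] yS ->//]].
  by have /imsetP[y _ xy] := subsetP SX _ xS; exists y => //; rewrite inE -xy.
exists (i @^-1: S); last exact: eS.
rewrite inE -(holds_on_emb _ _ iE) -eS ES andbT.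
apply/subsetP => y /[!inE] yS; have /imsetP[z zX /i_inj ->//] := subsetP SX _ yS.
Qed.

Variables (R : realType) (alpha : L -> R).
Local Notation deltaS := (deltaS alpha).
Local Notation delta := (delta alpha).

Lemma deltaS_emb A B (i : fdom A -> fdom B) (X : {set fdom A}) :
  emb (M := toL B) i -> deltaS (i @: X) = deltaS X.
Proof.
move=> iE; rewrite /Defs.deltaS card_imset; last by case: iE.
by congr (_ - _); apply: eq_bigr => E _; rewrite Nset_emb.
Qed.

Lemma inj_imsetS (T U : finType) (i : T -> U) (X Y : {set T}) : injective i ->
  (i @: X \subset i @: Y) = (X \subset Y).
Proof.
move=> i_inj; apply/idP/idP; last exact: imsetS.
by move=> /subsetP h; apply/subsetP => x /(imset_f i)/h; rewrite mem_imset.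
Qed.

Lemma subset_imsetP (T U : finType) (i : T -> U) (X : {set T}) (Z : {set U}) :
  Z \subset i @: X -> exists2 Z0 : {set T}, Z0 \subset X & Z = i @: Z0.
Proof.
move=> ZX; exists ([set x in X | i x \in Z]).
  by apply/subsetP => x /[!inE] /andP[].
apply/setP => z; apply/idP/imsetP => [zZ|[x /[!inE] /andP[_ xZ] ->//]].
have /imsetP[x xX zx] := subsetP ZX _ zZ.
by exists x => //; rewrite inE xX -zx zZ.
Qed.

Lemma le_within_emb A B (i : fdom A -> fdom B) (X Y : {set fdom A}) :
  emb (M := toL B) i -> le_within alpha (i @: X) (i @: Y) = le_within alpha X Y.
Proof.
move=> iE; have [i_inj _] := iE.
apply/forallP/forallP => h Z; apply/implyP => /andP[XZ ZY].
  by have := h (i @: Z); rewrite !deltaS_emb // !imsetS.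
have [Z0 Z0Y eZ] := subset_imsetP ZY; have := h Z0.
by rewrite eZ !deltaS_emb // Z0Y -(inj_imsetS _ _ i_inj) -eZ XZ.
Qed.

Lemma proper_imset_inj (T U : finType) (i : T -> U) (X Y : {set T}) : injective i ->
  (i @: X \proper i @: Y) = (X \proper Y).
Proof. by move=> i_inj; rewrite !properE !inj_imsetS. Qed.

Lemma minpair_emb A B (i : fdom A -> fdom B) (X Y : {set fdom A}) :
  emb (M := toL B) i -> minpair alpha (i @: X) (i @: Y) = minpair alpha X Y.
Proof.
move=> iE; have [i_inj _] := iE.
rewrite /minpair le_within_emb // (inj_imsetS _ _ i_inj); congr [&& _, _ & _].
apply/forallP/forallP => h Z; apply/implyP => /andP[XZ ZY].
  have := h (i @: Z).
  by rewrite le_within_emb // imsetS //= proper_imset_inj // ZY.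
have [Z0 Z0Y eZ] := subset_imsetP (proper_sub ZY); have := h Z0.
rewrite eZ le_within_emb // -(proper_imset_inj _ _ i_inj) -eZ ZY andbT.
by rewrite -(inj_imsetS _ _ i_inj) -eZ XZ.
Qed.

(** * Submodularity of delta, substructures of models and closed sets *)

Hypothesis alpha_gt0 : forall E, 0 < alpha E.
Let alpha_ge0 E : 0 <= alpha E := ltW (alpha_gt0 E).

Lemma Nset_super A E (X Y : {set fdom A}) :
  (Nset E X + Nset E Y <= Nset E (X :&: Y) + Nset E (X :|: Y))%N.
Proof.
rewrite /Nset -cardsUI addnC; apply: leq_add; apply: subset_leq_card.
  apply/subsetP => S; rewrite !inE => /andP[/andP[SX ->] /andP[SY _]].
  by rewrite subsetI SX SY.
apply/subsetP => S; rewrite !inE => /orP[]/andP[SX ->]; rewrite andbT.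
  exact: subset_trans SX (subsetUl _ _).
exact: subset_trans SX (subsetUr _ _).
Qed.

(** Edges inside [X] or inside [Y] lie inside the union, and those inside both lie inside the
    intersection, so edge counts are supermodular. *)
Lemma deltaS_submod A (X Y : {set fdom A}) :
  deltaS (X :|: Y) + deltaS (X :&: Y) <= deltaS X + deltaS Y.
Proof.
rewrite /Defs.deltaS.
have e : #|X :|: Y|%:R + #|X :&: Y|%:R = #|X|%:R + #|Y|%:R :> R.
  by rewrite -!natrD cardsUI.
have : \sum_E alpha E * (Nset E X)%:R + \sum_E alpha E * (Nset E Y)%:R <=
  \sum_E alpha E * (Nset E (X :&: Y))%:R + \sum_E alpha E * (Nset E (X :|: Y))%:R.
  rewrite -!big_split /=; apply: ler_sum => E _.
  by rewrite -!mulrDr ler_wpM2l // -!natrD ler_nat Nset_super.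
lra.
Qed.

Definition restr A (X : {set fdom A}) : finLstr ar :=
  FinLstr (fun E (a : {ffun 'I_(ar E) -> {x | x \in X}}) =>
    @Defs.frel _ _ A E [ffun k => val (a k)]).

Lemma emb_restr A (X : {set fdom A}) : emb (A := restr X) (M := toL A) val.
Proof. by apply/emb_toLP; split=> //; apply: val_inj. Qed.

Lemma imset_restr A (X : {set fdom A}) :
  [set val (a : fdom (restr X)) | a in setT] = X.
Proof.
apply/setP => x; apply/imsetP/idP => [[y _ ->]|xX]; first exact: valP.
by exists (Sub x xX).
Qed.

Lemma card_restr A (X : {set fdom A}) : #|fdom (restr X)| = #|X|.
Proof. by rewrite card_sig; apply: eq_card. Qed.

Definition induced M (T : finType) (f : T -> M) : finLstr ar :=
  FinLstr (fun E (a : {ffun 'I_(ar E) -> T}) => `[< @Defs.rel _ _ M E (fun k => f (a k)) >]).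

Lemma emb_induced M (T : finType) (f : T -> M) :
  injective f -> emb (A := induced f) f.
Proof. by move=> f_inj; split=> // E a; split=> /asboolP. Qed.

(** The union of the two ranges as a finite structure: in the sum of the domains, the points of [B]
    whose image is already reached by [f] are dropped. Submodularity is applied inside such
    unions. *)
Lemma joint A B M (f : fdom A -> M) (g : fdom B -> M) : emb f -> emb g ->
  exists (U : finLstr ar) (u : fdom U -> M) (i : fdom A -> fdom U) (j : fdom B -> fdom U),
  [/\ emb u, (forall a, u (i a) = f a), (forall b, u (j b) = g b) &
      i @: setT :|: j @: setT = setT].
Proof.
move=> fE gE; have [f_inj _] := fE; have [g_inj _] := gE.
pose P (x : fdom A + fdom B) :=
  if x is inr b then ~~ `[< exists a, f a = g b >] else true.
pose T : finType := {x | P x}.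
pose u (x : T) : M := match val x with inl a => f a | inr b => g b end.
have u_inj : injective u.
  move=> [[a|b] p] [[a'|b'] p']; rewrite /u /= => e; apply: val_inj => /=.
  - by rewrite (f_inj _ _ e).
  - by move: p'; rewrite /P => /asboolPn[]; exists a.
  - by move: p; rewrite /P => /asboolPn[]; exists a'.
  - by rewrite (g_inj _ _ e).
pose i (a : fdom A) : T := exist P (inl a) isT.
have jP b : exists t : T, u t = g b.
  have [[a ab]|nab] := pselect (exists a, f a = g b); first by exists (i a).
  have p : P (inr b) by rewrite /P; apply/asboolPn.
  by exists (exist P (inr b) p).
pose j b := projT1 (cid (jP b)).
have uj b : u (j b) = g b by rewrite /j; case: cid.
exists (induced u), u, i, j; split=> //; first exact: emb_induced.
apply/setP => x; rewrite !inE; case: x => [[a|b] p].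
  by apply/orP; left; apply/imsetP; exists a => //; apply: val_inj.
apply/orP; right; apply/imsetP; exists b => //; apply: u_inj; rewrite uj.
by [].
Qed.

Definition rclosed (r : nat) A M (f : fdom A -> M) := forall U (u : fdom U -> M) i,
  emb u -> (forall a, u (i a) = f a) -> (#|fdom U| <= #|fdom A| + r)%N ->
  delta A <= delta U.

Lemma delta_restr A (X : {set fdom A}) : delta (restr X) = deltaS X.
Proof. by rewrite /Defs.delta -(deltaS_emb setT (emb_restr X)) imset_restr. Qed.

Lemma rclosed_sub r A M (f : fdom A -> M) U (u : fdom U -> M) i (Z : {set fdom U}) :
  rclosed r f -> emb u -> (forall a, u (i a) = f a) ->
  i @: setT \subset Z -> (#|Z| <= #|fdom A| + r)%N -> delta A <= deltaS Z.
Proof.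
move=> fr uE ui iZ Zr; pose V := restr Z.
have iV a : i a \in Z by apply: (subsetP iZ); rewrite imset_f.
have := fr V (fun v => u (val v)) (fun a => Sub (i a) (iV a)).
rewrite card_restr delta_restr; apply => //.
exact: emb_comp (emb_restr Z) uE.
Qed.

Lemma minpairP A (X Y : {set fdom A}) : minpair alpha X Y ->
  [/\ X \subset Y, deltaS Y < deltaS X &
      forall Z : {set fdom A}, X \subset Z -> Z \proper Y -> deltaS X <= deltaS Z].
Proof.
case/and3P=> XY /forallP h nle.
have XZ (Z : {set fdom A}) : X \subset Z -> Z \proper Y -> deltaS X <= deltaS Z.
  move=> XZ ZY; have := h Z; rewrite XZ ZY /= => /forallP/(_ Z).
  by rewrite XZ subxx.
split=> //; rewrite ltNge; apply: contra nle => le.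
apply/forallP => Z; apply/implyP => /andP[sXZ]; rewrite subEproper.
by case/orP => [/eqP -> //|]; apply: XZ.
Qed.

(** * Gaps below zero in the values of delta, minimal pairs and closures *)

Lemma finite_lower_bound (T : finType) (F : T -> R) :
  (forall x, 0 < F x) -> exists2 eps, 0 < eps & forall x, eps <= F x.
Proof.
move=> F_gt0.
suff [e e0 he]: exists2 e, 0 < e & forall x, x \in enum T -> e <= F x.
  by exists e => // x; apply: he; rewrite mem_enum.
elim: (enum T) => [|x s [e e0 IH]]; first by exists 1.
exists (Num.min e (F x)) => [|y]; first by rewrite lt_min e0 F_gt0.
by rewrite inE ge_min => /orP[/eqP ->|/IH ->]; rewrite ?lexx ?orbT.
Qed.

Lemma weight_gap r : exists2 eps, 0 < eps & forall k (n : L -> nat), (k <= r)%N ->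
  k%:R - \sum_E alpha E * (n E)%:R < 0 -> k%:R - \sum_E alpha E * (n E)%:R <= - eps.
Proof.
(* [Q] edges of any single symbol outweigh [r] points by at least 1, so only multiplicities below
   [Q] need a separate bound, and these are finitely many. *)
have [Q hQ] : exists Q : nat, forall E, r%:R + 1 <= alpha E * Q%:R.
  have [e e0 he] := finite_lower_bound alpha_gt0.
  exists (Num.trunc ((r%:R + 1) / e)).+1 => E.
  apply: le_trans (_ : e * (Num.trunc ((r%:R + 1) / e)).+1%:R <= _).
    by rewrite mulrC -ler_pdivrMr // ltW // truncnS_gt.
  by rewrite ler_wpM2r.
(* The default 1 on non-negative values makes [F] positive everywhere. *)
pose F (x : {ffun L -> 'I_Q} * 'I_r.+1) : R :=
  let v := (x.2 : nat)%:R - \sum_E alpha E * (x.1 E : nat)%:R in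
  if v < 0 then - v else 1.
have [e e0 he] : exists2 eps, 0 < eps & forall x, eps <= F x.
  by apply: finite_lower_bound => x; rewrite /F; case: ifP => //; rewrite oppr_gt0.
exists (Num.min e 1) => [|k n kr neg]; first by rewrite lt_min e0 ltr01.
have [/forallP small|/forallPn[E]] := boolP [forall E, n E < Q]%N.
  have kr1 : (k < r.+1)%N by [].
  have := he ([ffun E => Ordinal (small E)], Ordinal kr1); rewrite /F /=.
  under eq_bigr => E _ do rewrite ffunE /=.
  by rewrite neg => h; rewrite lerNr ge_min h.
rewrite -leqNgt => big.
have : r%:R + 1 <= \sum_E alpha E * (n E)%:R.
  rewrite (bigD1 E) //=; apply: le_trans (hQ E) _.
  apply: le_trans (_ : alpha E * (n E)%:R <= _); first by rewrite ler_wpM2l // ler_nat.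
  by rewrite lerDl; apply: sumr_ge0 => F' _; rewrite mulr_ge0.
have : k%:R <= r%:R :> R by rewrite ler_nat.
have : Num.min e 1 <= 1 by rewrite ge_min lexx orbT.
lra.
Qed.

Lemma Nset_mono A E (X Y : {set fdom A}) : X \subset Y -> (Nset E X <= Nset E Y)%N.
Proof.
move=> XY; apply: subset_leq_card; apply/subsetP => S; rewrite !inE => /andP[SX ->].
by rewrite (subset_trans SX).
Qed.

(** The difference of the two values depends only on the numbers of added points and added edges,
    which makes the gap uniform over all structures. *)
Lemma delta_gap r : exists2 eps, 0 < eps & forall A (X Y : {set fdom A}),
  X \subset Y -> (#|Y| <= #|X| + r)%N -> deltaS Y < deltaS X -> deltaS Y <= deltaS X - eps.
Proof.
have [e e0 he] := weight_gap r; exists e => // A X Y XY Yr.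
have cXY := subset_leq_card XY.
have E : deltaS Y - deltaS X =
    (#|Y| - #|X|)%:R - \sum_E alpha E * (Nset E Y - Nset E X)%:R.
  have -> : \sum_E alpha E * (Nset E Y - Nset E X)%:R =
      \sum_E alpha E * (Nset E Y)%:R - \sum_E alpha E * (Nset E X)%:R.
    by rewrite -sumrB; apply: eq_bigr => E _; rewrite natrB ?Nset_mono // mulrBr.
  rewrite /Defs.deltaS natrB //; ring.
have := he (#|Y| - #|X|)%N (fun E => Nset E Y - Nset E X)%N.
rewrite -E subr_lt0 => h lt; have := h _ lt; rewrite leq_subLR => /(_ Yr).
lra.
Qed.

Lemma deltaS_le_card A (X : {set fdom A}) : deltaS X <= #|X|%:R.
Proof. by rewrite gerBl; apply: sumr_ge0 => E _; rewrite mulr_ge0. Qed.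

(** A witness against closedness is cut down to an inclusion-minimal set that contains the image of
    [A] and has smaller delta; minimality is exactly the minimal pair condition. *)
Lemma extend_minpair r A M (f : fdom A -> M) : emb f -> ~ rclosed r f ->
  exists U (u : fdom U -> M) (i : fdom A -> fdom U),
  [/\ emb u, forall a, u (i a) = f a, (#|fdom U| <= #|fdom A| + r)%N &
      minpair alpha (i @: setT) setT].
Proof.
move=> fE /existsNP[U /existsNP[u /existsNP[i]]].
move=> /not_implyP[uE /not_implyP[ui /not_implyP[Ur /negP]]]; rewrite -ltNge => lt.
have iE : emb (M := toL U) i by apply: emb_factor ui uE fE.
pose P (Z : {set fdom U}) := (i @: setT \subset Z) && (deltaS Z < delta A).
have PT : P setT by rewrite /P subsetT.
have [Z minZ _] := minset_exists PT.
have /andP[iZ ltZ] := minsetp minZ.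
have iV a : i a \in Z by apply: (subsetP iZ); rewrite imset_f.
pose V := restr Z; pose i' a : fdom V := Sub (i a) (iV a).
exists V, (fun v => u (val v)), i'; split => //.
- exact: emb_comp (emb_restr Z) uE.
- rewrite card_restr; apply: leq_trans Ur.
  by rewrite -[X in (_ <= X)%N]cardsT subset_leq_card // subsetT.
rewrite -(minpair_emb _ _ (emb_restr Z)) imset_restr.
have -> : [set val (a : fdom V) | a in i' @: setT] = i @: setT.
  by rewrite -imset_comp.
have dA : deltaS (i @: setT) = delta A by rewrite deltaS_emb.
rewrite /minpair iZ /=; apply/andP; split.
  apply/forallP => Y; apply/implyP => /andP[iY YZ].
  apply/forallP => Y'; apply/implyP => /andP[iY' Y'Y].
  rewrite dA leNgt; apply/negP => lt'.
  have eY : Y' = Z.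
    apply: (minsetinf minZ); last exact: subset_trans Y'Y (proper_sub YZ).
    by rewrite /P iY'.
  by move: YZ; rewrite properE -eY Y'Y andbF.
by apply/negP => /forallP/(_ Z); rewrite iZ subxx dA leNgt ltZ.
Qed.

Lemma chain_minimal_refl A : chain_minimal alpha (B := A) setT.
Proof. by exists [::] => /=. Qed.

Lemma path_minpair_emb A B (i : fdom A -> fdom B) (X : {set fdom A}) s :
  emb (M := toL B) i ->
  path (@minpair _ _ _ alpha B) (i @: X) [seq i @: Y | Y : {set fdom A} <- s] =
  path (@minpair _ _ _ alpha A) X s.
Proof.
by move=> iE; elim: s X => //= Y s IH X; rewrite minpair_emb // IH.
Qed.

Lemma chain_minimal_emb A B (i : fdom A -> fdom B) (X : {set fdom A}) :
  emb (M := toL B) i -> i @: setT = setT ->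
  chain_minimal alpha X -> chain_minimal alpha (i @: X).
Proof.
move=> iE iT [s /andP[sP /eqP sT]].
exists [seq i @: Y | Y : {set fdom A} <- s].
by rewrite path_minpair_emb // sP last_map sT iT eqxx.
Qed.

Lemma chain_minimal_extend A B (i : fdom A -> fdom B) (X : {set fdom A}) :
  emb (M := toL B) i -> minpair alpha (i @: setT) setT ->
  chain_minimal alpha X -> chain_minimal alpha (i @: X).
Proof.
move=> iE iT [s /andP[sP /eqP sT]].
exists (rcons [seq i @: Y | Y : {set fdom A} <- s] setT).
by rewrite rcons_path path_minpair_emb // sP last_rcons last_map sT iT eqxx.
Qed.

(* The common extension is reached by a chain of maximal length among the chains of
   minimal pairs of step at most [r]; its length is bounded because every step
   lowers delta by a fixed amount.  A failure of closedness in one of the two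
   models would extend the chain there, hence in both. *)
Lemma common_closure r : exists2 b : nat -> nat, {homo b : k l / (k <= l)%N} &
  forall M N A (f : fdom A -> M) (f' : fdom A -> N) m,
  model alpha M -> model alpha N -> emb f -> emb f' -> (b #|fdom A| <= m)%N ->
  (forall B (i : fdom A -> fdom B), emb (M := toL B) i -> inKalpha alpha B ->
     chain_minimal alpha (i @: setT) -> (#|fdom B| <= m)%N ->
     (exists2 g : fdom B -> M, emb g & forall a, g (i a) = f a) <->
     (exists2 g : fdom B -> N, emb g & forall a, g (i a) = f' a)) ->
  exists C (i : fdom A -> fdom C) (g : fdom C -> M) (g' : fdom C -> N),
  [/\ emb g /\ emb g', forall a, g (i a) = f a, forall a, g' (i a) = f' a,
      rclosed r g /\ rclosed r g' & (#|fdom C| <= b #|fdom A|)%N].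
Proof.
have [e e0 he] := delta_gap r.
(* Delta starts at [k] or less, stays non-negative and drops by at least [e] per step, which bounds
   the number of steps. The successor leaves room for the one further step that maximality refutes,
   since that step too must be transferred between the models. *)
pose b k := (k + r * (Num.trunc (k%:R / e)).+1)%N.
exists b => [k l kl|].
  rewrite /b leq_add // leq_mul // ltnS le_truncn // ler_pM2r ?invr_gt0 //.
  by rewrite ler_nat.
move=> M N A f f' m Mm Nm fE f'E bm H.
pose P n := exists C (i : fdom A -> fdom C) (g : fdom C -> M),
  [/\ emb g, forall a, g (i a) = f a, chain_minimal alpha (i @: setT),
      (#|fdom C| <= #|fdom A| + r * n)%N & delta C <= delta A - n%:R * e].
have Pbound n : P n -> (n <= Num.trunc (#|fdom A|%:R / e))%N.
  move=> [C [i [g [gE gi _ _ dC]]]].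
  have [_ /(_ setT) C0] := Mm.1 C g gE.
  have q0 : 0 <= #|fdom A|%:R / e by rewrite divr_ge0 // ltW.
  rewrite truncn_ge_nat // ler_pdivlMr //.
  have := deltaS_le_card (A := A) setT; rewrite cardsT -/(delta A).
  by move: C0 dC; rewrite -/(delta C); lra.
have P0 : P 0%N.
  exists A, id, f; split => //; last by rewrite mul0r subr0.
    by rewrite imset_id; apply: chain_minimal_refl.
  by rewrite muln0 addn0.
have [n Pn nmax] : exists2 n, P n & ~ P n.+1.
  apply: contrapT => no.
  have all n : P n by elim: n => // n Pn; apply: contrapT => h; apply: no; exists n.
  by have := Pbound _ (all (Num.trunc (#|fdom A|%:R / e)).+1); rewrite ltnn.
have [C [i [g [gE gi Cch Csz Cd]]]] := Pn.
have CK := Mm.1 _ _ gE.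
have iE : emb (M := toL C) i by apply: emb_factor gi gE fE.
have szP k (D : finLstr ar) : P k -> (#|fdom D| <= #|fdom A| + r * k.+1)%N ->
    (#|fdom D| <= b #|fdom A|)%N.
  move=> /Pbound kb /leq_trans; apply; rewrite leq_add2l.
  by rewrite leq_mul2l ltnS kb orbT.
have Cb : (#|fdom C| <= b #|fdom A|)%N.
  apply: szP Pn _; apply: leq_trans Csz _; rewrite leq_add2l leq_mul2l leqnSn.
  exact: orbT.
have [g' g'E g'i] := (H C i iE CK Cch (leq_trans Cb bm)).1 (ex_intro2 _ _ g gE gi).
have ext (K : Lstr ar) (h : fdom C -> K) U (u : fdom U -> K) (j : fdom C -> fdom U) :
    emb h -> emb u -> (forall a, u (j a) = h a) ->
    (#|fdom U| <= #|fdom C| + r)%N -> minpair alpha (j @: setT) setT ->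
    [/\ emb (M := toL U) (fun a => j (i a)),
       chain_minimal alpha ((fun a => j (i a)) @: setT),
       (#|fdom U| <= #|fdom A| + r * n.+1)%N & delta U <= delta A - n.+1%:R * e].
  move=> hE uE uj Ur mp; have jE : emb (M := toL U) j by apply: emb_factor uj uE hE.
  split.
  - exact: (emb_comp (M := toL U) iE jE).
  - have -> : [set j (i a) | a in setT] = j @: (i @: setT) by rewrite -imset_comp.
    exact: chain_minimal_extend.
  - by apply: leq_trans Ur _; rewrite mulnS addnCA addnC leq_add2l.
  have [jT lt _] := minpairP mp.
  have := he _ _ _ jT; rewrite cardsT card_imset ?cardsT; last by case: jE.
  move=> /(_ Ur lt); rewrite deltaS_emb // -/(delta U) -/(delta C).
  by move: Cd; rewrite -natr1; lra.
have gr : rclosed r g.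
  apply: contrapT => /(extend_minpair gE)[U [u [j [uE uj Ur mp]]]].
  have [h1 h2 h3 h4] := ext _ _ _ _ _ gE uE uj Ur mp.
  by apply: nmax; exists U, (fun a => j (i a)), u; split => // a; rewrite uj.
exists C, i, g, g'; split=> //; split=> //.
apply: contrapT => /(extend_minpair g'E)[U [u [j [uE uj Ur mp]]]].
have [h1 h2 h3 h4] := ext _ _ _ _ _ g'E uE uj Ur mp.
apply: nmax.
have Um := leq_trans (szP _ _ Pn h3) bm.
have UK := Nm.1 _ _ uE.
have [w wE wi] : exists2 w : fdom U -> M, emb w & forall a, w (j (i a)) = f a.
  apply: (H U (fun a => j (i a)) h1 UK h2 Um).2.
  by exists u => // a; rewrite uj.
by exists U, (fun a => j (i a)), w.
Qed.

(* If [(Y, Z)] is a minimal pair with [Y] inside a closed set [W] but [Z] not, then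
   delta drops from [Z :&: W] to [Z], so by submodularity from [W] to [Z :|: W]. *)
Lemma chain_in_closed r M A B (f : fdom A -> M) (g : fdom B -> M) (X : {set fdom B}) :
  emb f -> emb g -> rclosed r f -> (#|fdom B| <= r)%N -> chain_minimal alpha X ->
  (forall b, b \in X -> exists a, f a = g b) -> forall b, exists a, f a = g b.
Proof.
move=> fE gE fr Br [s /andP[sP /eqP sT]] Xf.
have [U [u [i [j [uE ui uj UT]]]]] := joint fE gE.
have [u_inj _] := uE.
have iE : emb (M := toL U) i by apply: emb_factor ui uE fE.
have jE : emb (M := toL U) j by apply: emb_factor uj uE gE.
pose W : {set fdom U} := i @: setT.
have step (Y Z : {set fdom B}) : minpair alpha Y Z -> j @: Y \subset W -> j @: Z \subset W.
  move=> /minpairP[YZ lt mn] YW; apply: contrapT => /negP nZW.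
  pose Z0 := [set z in Z | j z \in W].
  have Z0Z : Z0 \subset Z by apply/subsetP => z; rewrite inE => /andP[].
  have YZ0 : Y \subset Z0.
    apply/subsetP => y yY; rewrite inE (subsetP YZ) //=.
    by apply: (subsetP YW); rewrite imset_f.
  have pZ0 : Z0 \proper Z.
    rewrite properE Z0Z; apply: contra nZW => /subsetP h.
    by apply/subsetP => _ /imsetP[z /h /[!inE] /andP[_ ?] ->].
  have eI : j @: Z :&: W = j @: Z0.
    apply/setP => x; rewrite inE; apply/andP/imsetP.
      by move=> [/imsetP[z zZ ->] zW]; exists z; rewrite // inE zZ.
    by move=> [z /[!inE] /andP[zZ zW] ->]; rewrite imset_f.
  have := deltaS_submod (j @: Z) W; rewrite eI !(deltaS_emb _ jE).
  have := mn _ YZ0 pZ0.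
  have : delta A <= deltaS (j @: Z :|: W).
    apply: (rclosed_sub fr uE ui); first exact: subsetUr.
    apply: leq_trans (_ : #|j @: Z| + #|W| <= _)%N.
      by rewrite -cardsUI leq_addr.
    rewrite addnC leq_add //.
      by rewrite (leq_trans (leq_imset_card _ _)) // cardsT.
    by rewrite (leq_trans (leq_imset_card _ _)) // (leq_trans (max_card _)).
  have -> : deltaS W = delta A by rewrite deltaS_emb.
  lra.
have XW : j @: X \subset W.
  apply/subsetP => _ /imsetP[b /Xf[a ab] ->]; apply/imsetP; exists a => //.
  by apply: u_inj; rewrite ui uj.
have TW : j @: setT \subset W.
  elim: s X XW sP sT {Xf} => [|Y s IH] X XW /= => [_ <-|/andP[XY /IH]] //; apply.
  exact: step XY XW.
move=> b; have /imsetP[a _ ab] := subsetP TW _ (imset_f j (in_setT b)).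
by exists a; rewrite -ui -uj ab.
Qed.

(** * Semantics and free variables of extension formulas *)

Lemma sat_exs M (rho : nat -> M) vs f :
  sat rho (exs vs f) <->
  exists2 rho' : nat -> M, (forall k, k \notin vs -> rho' k = rho k) & sat rho' f.
Proof.
elim: vs rho => [|i vs IH] rho /=.
  by split=> [|[rho' /(_ _ isT) h]]; [exists rho | rewrite (funext h)].
split=> [[m /IH[rho' h sf]]|[rho' h sf]].
  exists rho' => // k; rewrite inE negb_or => /andP[/negPf ki kvs].
  by rewrite h // ki.
exists (rho' i); apply/IH; exists rho' => // k kvs.
by case: eqP => [->//|/eqP ki]; apply: h; rewrite inE negb_or ki.
Qed.

Lemma sat_diag M (rho : nat -> M) A (P : {set fdom A}) (v : fdom A -> nat) :
  sat rho (diag P v) <->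
  (forall E (a : {ffun 'I_(ar E) -> fdom A}), (forall k, a k \in P) ->
     Defs.frel a <-> @Defs.rel _ _ M E (fun k => rho (v (a k)))) /\
  (forall b c, b \in P -> c \in P -> b = c <-> rho (v b) = rho (v c)).
Proof.
have bigP (T : eqType) (h : T -> Defs.form ar) s :
    sat rho (bigAnd (map h s)) <-> forall x, x \in s -> sat rho (h x).
  elim: s => //= x s IH; split => [[hx /IH hs] y|h0].
    by rewrite inE => /orP[/eqP ->|/hs].
  split; first by apply: h0; rewrite inE eqxx.
  by apply/IH => y ys; apply: h0; rewrite inE ys orbT.
have catP s t : sat rho (bigAnd (s ++ t)) <-> sat rho (bigAnd s) /\ sat rho (bigAnd t).
  by elim: s => //= [|f s IH]; [tauto | rewrite IH; tauto].
have flatP (T : eqType) (h : T -> seq (Defs.form ar)) s :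
    sat rho (bigAnd (flatten (map h s))) <-> forall x, x \in s -> sat rho (bigAnd (h x)).
  elim: s => //= x s IH; rewrite catP IH; split => [[hx hs] y|h0].
    by rewrite inE => /orP[/eqP ->|/hs].
  split; first by apply: h0; rewrite inE eqxx.
  by move=> y ys; apply: h0; rewrite inE ys orbT.
rewrite /diag catP flatP flatP; split=> -[h1 h2]; split.
- move=> E a aP; have /bigP/(_ a) := h1 E (mem_enum _ E).
  rewrite mem_filter mem_enum andbT /relLit => /(_ (introT forallP aP)).
  by case: ifP => _ /=; split.
- move=> b c bP cP; have := h2 b; rewrite mem_enum => /(_ bP)/bigP/(_ c).
  by rewrite mem_enum /eqLit => /(_ cP); case: eqP => bc /=; split.
- move=> E _; apply/bigP => a; rewrite mem_filter /relLit => /andP[/forallP aP _].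
  by have := h1 E a aP; case: ifP => _ /= [h h']; [apply: h | move=> /h'].
move=> b; rewrite mem_enum => bP; apply/bigP => c; rewrite mem_enum => cP.
by have [h h'] := h2 b c bP cP; rewrite /eqLit; case: eqP => //= bc /h'.
Qed.

(** The diagram decides all equalities and relations, so values of the variables [v b] satisfy it
    exactly when they form an embedding; injectivity of [v] lets any embedding be read as an
    assignment. *)
Lemma sat_ExtF M (rho : nat -> M) B (X : {set fdom B}) (v : fdom B -> nat) :
  injective v ->
  sat rho (ExtF X v) <->
  exists2 g : fdom B -> M, emb g & forall b, b \in X -> g b = rho (v b).
Proof.
move=> v_inj; split => [[_ /sat_exs[rho' h /sat_diag[h1 h2]]]|[g gE gX]].
  exists (fun b => rho' (v b)).
    split=> [b c /h2|E a]; first by apply; rewrite inE.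
    by apply: h1 => k; rewrite inE.
  move=> b bX; apply: h; apply/mapP => -[c]; rewrite mem_enum inE => cX /v_inj bc.
  by rewrite -bc bX in cX.
have [g_inj gP] := gE.
split.
  apply/sat_diag; split=> [E a aX|b c bX cX]; last first.
    by rewrite -!gX //; split=> [->|/g_inj].
  rewrite gP; have -> // : (fun k => g (a k)) = (fun k => rho (v (a k))).
  by apply/funext => k; rewrite gX.
pose rho' k := if [pick b | v b == k] is Some b then g b else rho k.
have rv b : rho' (v b) = g b.
  by rewrite /rho'; case: pickP => [c /eqP/v_inj -> //|/(_ b)]; rewrite eqxx.
apply/sat_exs; exists rho'.
  move=> k kX; rewrite /rho'; case: pickP => // b /eqP vb.
  rewrite gX ?vb //; apply: contraNT kX => bX; apply/mapP; exists b => //.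
  by rewrite mem_enum inE.
apply/sat_diag; split=> [E a _|b c _ _]; last by rewrite !rv; split=> [->|/g_inj].
by rewrite gP; under [in X in _ <-> X]eq_fun => k do rewrite rv.
Qed.

Lemma fv_exs vs (f : Defs.form ar) k : k \in fv (exs vs f) -> k \in fv f /\ k \notin vs.
Proof.
elim: vs => //= i vs IH; rewrite mem_filter inE negb_or => /andP[ki /IH[? ?]].
by rewrite ki.
Qed.

Lemma fv_diag B (P : {set fdom B}) (v : fdom B -> nat) k :
  k \in fv (diag P v) -> exists2 b, b \in P & k = v b.
Proof.
have bigP (T : eqType) (h : T -> Defs.form ar) s :
    k \in fv (bigAnd (map h s)) -> exists2 x, x \in s & k \in fv (h x).
  elim: s => //= x s IH; rewrite mem_cat => /orP[kx|/IH[y ys ky]].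
    by exists x; rewrite // inE eqxx.
  by exists y; rewrite // inE ys orbT.
have catP s t : fv (bigAnd (s ++ t)) = fv (bigAnd s) ++ fv (bigAnd t).
  by elim: s => //= f s ->; rewrite catA.
have flatP (T : eqType) (h : T -> seq (Defs.form ar)) s :
    k \in fv (bigAnd (flatten (map h s))) -> exists2 x, x \in s & k \in fv (bigAnd (h x)).
  elim: s => //= x s IH; rewrite catP mem_cat => /orP[kx|/IH[y ys ky]].
    by exists x; rewrite // inE eqxx.
  by exists y; rewrite // inE ys orbT.
rewrite /diag catP mem_cat => /orP[/flatP[E _ /bigP[a]]|/flatP[b bP /bigP[c cP]]].
  rewrite mem_filter => /andP[/forallP aP _].
  by rewrite /relLit; case: ifP => _ /= /mapP[l _ ->]; exists (a l).
move: bP cP; rewrite !mem_enum => bP cP.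
by rewrite /eqLit; case: ifP => _; rewrite /= !inE => /orP[]/eqP ->;
  [exists b|exists c|exists b|exists c].
Qed.

Lemma fv_ExtF B (X : {set fdom B}) (v : fdom B -> nat) k :
  k \in fv (ExtF X v) -> exists2 b, b \in X & k = v b.
Proof.
rewrite mem_cat => /orP[/fv_diag //|/fv_exs[/fv_diag[b _ ->] h]].
exists b => //; apply: contraNT h => bX; apply/mapP; exists b => //.
by rewrite mem_enum inE.
Qed.

End Basics.

(** * Division of natural numbers by a real weight *)

Section Remainders.
Variables (R : realType) (a : R).
Hypothesis a_gt0 : 0 < a.

(** Quotient and remainder of [i] by the real number [a]. The remainder is the delta of [i] points
    carrying as many edges of weight [a] as keep it non-negative. *)
Definition wquo (i : nat) : nat := Num.trunc (i%:R / a).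
Definition wrem (i : nat) : R := i%:R - a * (wquo i)%:R.
Local Notation quo := wquo.
Local Notation rem := wrem.

Lemma rem_itv i : 0 <= rem i < a.
Proof.
have q0 : 0 <= i%:R / a by rewrite divr_ge0 // ltW.
have := truncn_itv q0; rewrite ler_pdivlMr // ltr_pdivrMr // -/(quo i) -natr1 /wrem.
lra.
Qed.

Lemma rem_ge0 i : 0 <= rem i. Proof. by case/andP: (rem_itv i). Qed.
Lemma rem_lt i : rem i < a. Proof. by case/andP: (rem_itv i). Qed.

Lemma quo_rem_unique i (q : nat) y :
  i%:R = a * q%:R + y -> 0 <= y < a -> quo i = q /\ rem i = y.
Proof.
move=> e /andP[y0 ya].
have qi : quo i = q.
  apply: truncn_def; rewrite ler_pdivlMr // ltr_pdivrMr // -natr1 e; lra.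
by split=> //; rewrite /wrem qi e; lra.
Qed.

(* If all remainders stay below [t < a], then adding a remainder to itself until it
   passes [a] produces a remainder that is smaller by at least [a - t]. *)
Lemma rem_dense : (forall i q : nat, (0 < i)%N -> i%:R <> a * q%:R) ->
  forall t, t < a -> exists m, t < rem m.
Proof.
move=> irr t ta; apply: contrapT => /forallNP no.
have {}no i : rem i <= t by rewrite leNgt; apply/negP; apply: no.
have rem_gt0 i : (0 < i)%N -> 0 < rem i.
  move=> i0; rewrite lt_neqAle rem_ge0 andbT eq_sym; apply/eqP => e.
  by apply: (irr i (quo i) i0); move: e; rewrite /wrem; lra.
have step d : (0 < d)%N -> exists2 d', (0 < d')%N & rem d' <= rem d - (a - t).
  move=> d0; set x := rem d; have x0 : 0 < x by apply: rem_gt0.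
  have ed : d%:R = a * (quo d)%:R + x by rewrite /x /wrem; lra.
  have ax0 : 0 <= a / x by rewrite divr_ge0 // ltW.
  have := truncn_itv ax0; rewrite ler_pdivlMr // ltr_pdivrMr // -natr1.
  set k := Num.trunc _ => /andP[]; rewrite le_eqVlt => /orP[/eqP e _|kx ak].
    have k0 : (0 < k)%N by rewrite lt0n; apply/eqP => k0; move: a_gt0; rewrite -e k0 mul0r ltxx.
    case: (irr (k * d)%N (k * quo d + 1)%N); first by rewrite muln_gt0 k0.
    by rewrite natrM natrD natrM ed; lra.
  have kx0 : 0 <= k%:R * x by rewrite mulr_ge0 // ltW.
  have [_ e1] : quo (k * d) = (k * quo d)%N /\ rem (k * d) = k%:R * x.
    apply: quo_rem_unique; last by rewrite kx0.
    by rewrite !natrM ed; ring.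
  have := no (k * d)%N; rewrite e1 => kxt.
  have xa := rem_lt d; rewrite -/x in xa.
  have [_ e2] : quo (k.+1 * d) = (k.+1 * quo d + 1)%N /\
      rem (k.+1 * d) = (k%:R + 1) * x - a.
    apply: quo_rem_unique; last by lra.
    by rewrite natrD !natrM -natr1 ed; ring.
  by exists (k.+1 * d)%N; rewrite ?muln_gt0 // e2; lra.
have steps n : exists2 d, (0 < d)%N & rem d <= a - n%:R * (a - t).
  elim: n => [|n [d d0 dn]]; first by exists 1%N => //; have := rem_lt 1; lra.
  by have [d' d'0 d'n] := step _ d0; exists d' => //; rewrite -natr1; lra.
have at0 : 0 < a - t by lra.
have [d d0] := steps (Num.trunc (a / (a - t))).+1.
have := rem_gt0 _ d0; have := truncnS_gt (a / (a - t)); rewrite ltr_pdivrMr //.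
lra.
Qed.

(** The least index whose remainder exceeds a threshold is a record. A threshold of at least
    [a - eps] that also bounds all remainders below index [m0] makes this record close to [a] and
    late. A gadget of that length has delta in [(-eps, 0)]. *)
Lemma rem_record : (forall i q : nat, (0 < i)%N -> i%:R <> a * q%:R) ->
  forall eps m0, 0 < eps -> exists m,
  [/\ (m0 <= m)%N, a - rem m < eps & forall i, (0 < i < m)%N -> rem i <= rem m].
Proof.
move=> irr eps m0 eps0.
have [t [ta te tm]] : exists t, [/\ t < a, a - eps <= t & forall i, (i < m0)%N -> rem i <= t].
  elim: m0 => [|m0 [t [ta te tm]]]; first by exists (a - eps); split=> //; lra.
  exists (Num.max t (rem m0)); split.
  - by rewrite gt_max ta rem_lt.
  - by rewrite le_max te.
  - by move=> i; rewrite ltnS leq_eqVlt le_max => /orP[/eqP ->|/tm ->]; rewrite ?lexx ?orbT.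
have ex : exists m, t < rem m := rem_dense irr ta.
case: (ex_minnP ex) => m tm' mmin; exists m; split.
- by rewrite leqNgt; apply/negP => /tm; lra.
- lra.
move=> i /andP[_ im]; apply: le_trans (ltW tm').
by rewrite leNgt; apply/negP => /mmin; rewrite leqNgt im.
Qed.

(** Here [a = i0 / q0], so the remainders have period [i0] and their maximum is attained arbitrarily
    late. The number [x] is [q0 * eta] written out with [i0] in place of [a * q0]. *)
Lemma rem_record_rational (i0 q0 : nat) : (0 < i0)%N -> i0%:R = a * q0%:R ->
  exists eta (x : nat), [/\ 0 < eta, q0%:R * eta = x%:R & forall m0, exists m,
   [/\ (m0 <= m)%N, a - rem m = eta & forall i, (0 < i < m)%N -> rem i <= rem m]].
Proof.
move=> i00 e0.
have remD i k : rem (i + k * i0) = rem i.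
  have [//] : quo (i + k * i0) = (quo i + k * q0)%N /\ rem (i + k * i0) = rem i.
  apply: quo_rem_unique; last exact: rem_itv.
  by rewrite !natrD !natrM e0 /wrem; ring.
have [i1 i1max] : exists i1, forall i, rem i <= rem i1.
  have [j _ jmax] : exists2 j : 'I_i0, true & forall i : 'I_i0, rem i <= rem j.
    have [j _ jm] := arg_maxP (fun i : 'I_i0 => rem i) (i0 := Ordinal i00) (P := xpredT) isT.
    by exists j => // i; apply: jm.
  exists j => i; rewrite (divn_eq i i0) addnC remD.
  by have := jmax (Ordinal (ltn_pmod i i00)).
exists (a - rem i1), (i0 + i0 * quo i1 - q0 * i1)%N.
have e : q0%:R * (a - rem i1) = (i0 + i0 * quo i1)%:R - (q0 * i1)%:R.
  by rewrite natrD !natrM e0 /wrem; ring.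
have eta0 : 0 < a - rem i1 by have := rem_lt i1; lra.
have le : (q0 * i1 <= i0 + i0 * quo i1)%N.
  by rewrite -(ler_nat R) -subr_ge0 -e mulr_ge0 // ltW.
split=> //; first by rewrite natrB.
move=> m0; exists (i1 + m0 * i0)%N; rewrite remD; split=> //.
by rewrite (leq_trans (leq_pmulr m0 i00)) // leq_addl.
Qed.

End Remainders.

Lemma card_sum_set (T U : finType) (Z : {set T + U}) :
  #|Z| = (#|[set x | inl x \in Z]| + #|[set y | inr y \in Z]|)%N.
Proof.
rewrite -(card_imset _ (@inl_inj T U)) -(card_imset _ (@inr_inj T U)) -cardsUI.
set A := inl @: _; set B := inr @: _.
have inlA x : (inl x \in A) = (inl x \in Z) by rewrite mem_imset ?inE //; exact: inl_inj.
have inrB y : (inr y \in B) = (inr y \in Z) by rewrite mem_imset ?inE //; exact: inr_inj.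
have inrA y : (inr y \in A) = false by apply/imsetP => -[].
have inlB x : (inl x \in B) = false by apply/imsetP => -[].
have -> : A :&: B = set0.
  by apply/setP => -[x|y]; rewrite !inE ?inlB ?inrA // andbF.
by rewrite cards0 addn0; apply: eq_card => -[x|y]; rewrite !inE ?inlA ?inrB ?inrA ?inlB ?orbF.
Qed.

(** * Gadgets of small negative relative delta *)

(* A gadget over a base [D] has new points [0, ..., m-1].  Point [i] lies on
   [quo i.+1 - quo i] edges inside [D] and the points up to [i], one of which also
   contains [i.-1] when [0 < i]; the last point lies on one more edge.  Hence the first
   [i] points have delta [rem i] over [D], and the whole gadget has delta
   [rem m - a]. *)
Section Gadget.
Variables (R : realType) (a : R) (a_gt0 : 0 < a) (a_le1 : a <= 1).
Local Notation rem := (wrem a).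
Local Notation quo := (wquo a).

Lemma quo0 : quo 0 = 0%N /\ rem 0 = 0.
Proof. by apply: (quo_rem_unique a_gt0); rewrite ?mulr0 ?addr0 // lexx. Qed.

(** As [a <= 1], one more point pays for at least one more edge. Thus every gadget point has an edge
    that can link it to its predecessor. *)
Lemma quo_lt i : (quo i < quo i.+1)%N.
Proof.
have h0 := rem_ge0 a_gt0 i; have h1 := rem_lt a_gt0 i.+1.
rewrite -(ltr_nat R) -(ltr_pM2l a_gt0).
move: h0 h1 a_le1; rewrite /wrem -natr1; lra.
Qed.

Lemma quo_le i j : (i <= j)%N -> (quo i <= quo j)%N.
Proof. by move=> ij; apply: (homo_leq leqnn leq_trans (fun i => ltnW (quo_lt i))). Qed.

Variables (m : nat) (m_gt0 : (0 < m)%N).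

Definition degree (i : nat) : nat := (quo i.+1 - quo i + (i.+1 == m))%N.

Lemma sum_degree : (\sum_(i < m) degree i = (quo m).+1)%N.
Proof.
rewrite big_split /= -(big_mkord xpredT (fun i => quo i.+1 - quo i)%N) telescope_sumn_in //;
  last by move=> i _; apply: quo_le (leqnSn i).
rewrite (proj1 quo0) subn0; case: (m) m_gt0 => // n _.
by rewrite big_ord_recr /= eqxx big1 ?addn0 ?addn1 // => i _; rewrite eqSS ltn_eqF.
Qed.

Lemma degree_le i : (i < m)%N -> (degree i <= (quo m).+1)%N.
Proof.
move=> im; rewrite /degree -[(quo m).+1]addn1 leq_add //; last by case: eqP.
by apply: leq_trans (leq_subr _ _) (quo_le im).
Qed.

Hypothesis rem_max : forall i, (0 < i < m)%N -> rem i <= rem m.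

(* [g j] is a lower bound for the relative delta of the points [i < j] with [P i],
   without the extra edge at the last point.  A run of consecutive points starting at
   [i > 0] contributes [a + rem j - rem i], since the path edge at [i] is missing. *)
Lemma sparse_sum (P : pred nat) : (exists2 i, (i < m)%N & ~~ P i) ->
  a * (\sum_(i < m | P i) (degree i - ((0 < i)%N && ~~ P i.-1)))%:R <=
  (\sum_(i < m | P i) 1)%:R.
Proof.
move=> [i0 i0m nPi0].
pose g j : R := \sum_(i < j | P i) (rem i.+1 - rem i + a * ((0 < i)%N && ~~ P i.-1)%:R).
have gS j : g j.+1 = g j + (if P j then rem j.+1 - rem j + a * ((0 < j)%N && ~~ P j.-1)%:R else 0).
  by rewrite /g [LHS]big_mkcond big_ord_recr /= -big_mkcond.
(* The scan is in its possibly empty first run, outside [P], or in a run that started at some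
   [i > 0]. When such a run ends, [rem i < a] leaves [g] non-negative. *)
have walk j : (g j = rem j /\ forall i, (i < j)%N -> P i) \/
   [/\ (0 < j)%N, ~~ P j.-1 & 0 <= g j] \/
   [/\ (0 < j)%N, P j.-1 & exists2 i, (0 < i < j)%N & a + rem j - rem i <= g j].
  elim: j => [|j IH]; first by left; rewrite /g big_ord0 (proj2 quo0).
  have rj0 := rem_ge0 a_gt0 j; have rj1 := rem_ge0 a_gt0 j.+1.
  have [Pj|nPj] := boolP (P j); last first.
    right; left; rewrite gS (negPf nPj) addr0; split=> //.
    case: IH => [[-> _]//|[[]//|[_ _ [i _]]]].
    by have := rem_lt a_gt0 i; lra.
  rewrite gS Pj; case: IH => [[-> all]|[[j0 nP g0]|[j0 Pj' [i /andP[i0' ij] gi]]]].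
  - left; split; last by move=> i; rewrite ltnS leq_eqVlt => /orP[/eqP ->|/all].
    have -> : (0 < j)%N && ~~ P j.-1 = false.
      by case: (j) all => //= k /(_ k (ltnSn k)) ->.
    by rewrite mulr0; lra.
  - right; right; split=> //; exists j; first by rewrite j0 /=.
    by rewrite j0 nP mulr1; lra.
  right; right; split=> //; exists i; first by rewrite i0' ltnW.
  by rewrite Pj' andbF mulr0; lra.
have degE (i : 'I_m) : (((0 < i)%N && ~~ P i.-1) <= degree i)%N.
  rewrite /degree; apply: leq_trans (leq_addr _ _).
  by rewrite (leq_trans (leq_b1 _)) // subn_gt0 quo_lt.
rewrite !natr_sum mulr_sumr -subr_ge0 -sumrB.
have -> : \sum_(i < m | P i) (1%:R - a * (degree i - ((0 < i)%N && ~~ P i.-1))%:R) =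
    g m - a * (P m.-1)%:R.
  have -> : a * (P m.-1)%:R = \sum_(i < m | P i) a * (i.+1 == m)%:R.
    rewrite big_mkcond /=; case: (m) m_gt0 => // n _.
    rewrite big_ord_recr /= eqxx big1 ?add0r; first by case: ifP; rewrite ?mulr0.
    by move=> i _; rewrite eqSS ltn_eqF // mulr0 if_same.
  rewrite -sumrB; apply: eq_bigr => i Pi.
  rewrite natrB ?degE // /degree natrD natrB ?quo_le //.
  by rewrite /wrem -natr1; ring.
(* The extra edge of the last point costs [a], and only if that point lies in [P]. Its run then
   starts at some [i > 0], and what remains is [rem m - rem i], non-negative by the record
   property. *)
case: (walk m) => [[_ /(_ _ i0m)]|[[_ /negPf -> g0]|[_ -> [i im gi]]]].
- by rewrite (negPf nPi0).
- by rewrite mulr0 subr0.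
by rewrite mulr1; have := rem_max im; lra.
Qed.

(** [pa i] is the base part of the edge joining point [i] to its predecessor, [pd i l] that of the
    edge number [l] having [i] as its only new point. For [i > 0] the number 0 is given to the path
    edge, whence the condition on [l] in [cover]. *)
Variables (G : finType) (D : {set G}) (k : nat) (pa : nat -> {set G}) (pd : nat -> nat -> {set G}).
Hypothesis k_ge2 : (2 <= k)%N.
Hypothesis paD : forall i, (i < m)%N -> pa i \subset D.
Hypothesis pdD : forall i l, (i < m)%N -> (l < degree i)%N -> pd i l \subset D.
Hypothesis card_pa : forall i, (i < m)%N -> #|pa i| = k.-2.
Hypothesis card_pd : forall i l, (i < m)%N -> (l < degree i)%N -> #|pd i l| = k.-1.
Hypothesis pd_inj : forall i l l', (i < m)%N -> (l < degree i)%N -> (l' < degree i)%N ->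
  pd i l = pd i l' -> l = l'.
Hypothesis cover : forall d, d \in D ->
  (exists2 i, (0 < i < m)%N & d \in pa i) \/
  (exists i l, [/\ (i < m)%N, (l < degree i)%N, (i == 0)%N || (0 < l)%N & d \in pd i l]).

Local Notation index := ('I_m * 'I_(quo m).+2)%type.

Definition indices : {set index} := [set x : index | (x.2 < degree x.1)%N].

Definition on_path (x : index) : bool := (x.2 == 0%N :> nat) && (0 < x.1)%N.

Definition gadget_edge (x : index) : {set G + 'I_m} :=
  [set z | match z with
    | inl g => g \in (if on_path x then pa x.1 else pd x.1 x.2)
    | inr w => (w == x.1) || on_path x && (w.+1 == x.1)
    end].

Definition gadget : {set {set G + 'I_m}} := gadget_edge @: indices.

Lemma card_indices : #|indices| = (quo m).+1.
Proof.
transitivity (\sum_(i < m) degree i)%N; last exact: sum_degree.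
rewrite -sum1_card.
rewrite (eq_bigl (fun x : index => xpredT x.1 && (x.2 < degree x.1)%N)); last first.
  by move=> x; rewrite inE.
rewrite -(pair_big_dep xpredT (fun (i : 'I_m) (l : 'I_(quo m).+2) => l < degree i)%N
  (fun _ _ => 1%N)) /=.
apply: eq_bigr => i _.
have di : (degree i <= (quo m).+2)%N by rewrite leqW // degree_le.
by rewrite (big_ord_narrow di) sum1_card card_ord.
Qed.

(** The highest new point of an edge gives [i], the presence of a lower new point tells whether it
    is a path edge, and otherwise the base part gives [l]. *)
Lemma gadget_edge_inj : {in indices &, injective gadget_edge}.
Proof.
move=> x y xI yI /setP e.
have top (x' y' : index) : gadget_edge x' =i gadget_edge y' -> (x'.1 <= y'.1)%N.
  move=> /(_ (inr x'.1)); rewrite !inE eqxx => /esym/orP[/eqP ->//|/andP[_ /eqP <-]].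
  exact: leqnSn.
have e1 : x.1 = y.1.
  by apply/val_inj/anti_leq; rewrite !top // => z; rewrite e.
have pathE (x' : index) :
    on_path x' = [exists w : 'I_m, (inr w \in gadget_edge x') && (w < x'.1)%N].
  apply/idP/existsP => [p|[w /andP[+ wx]]].
    have x0 : (x'.1.-1 < m)%N by apply: leq_ltn_trans (leq_pred _) (ltn_ord _).
    have x1 : (0 < x'.1)%N by case/andP: p.
    by exists (Ordinal x0); rewrite !inE p /= prednK // eqxx orbT leqnn.
  by rewrite inE -val_eqE (ltn_eqF wx) => /andP[].
have epath : on_path x = on_path y.
  by rewrite !pathE; apply: eq_existsb => w; rewrite e e1.
case: x y xI yI e e1 epath => [i l] [i' l'] /= + + e e1.
rewrite !inE /= -{i'}e1 in e * => li li' ep.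
congr (_, _); apply: val_inj.
have [p|np] := boolP (on_path (i, l)).
  by move: ep; rewrite p => /esym; case/andP: p => /eqP /= -> _ /andP[/eqP /= ->].
apply: (pd_inj (ltn_ord i)) => //; apply/setP => g; have := e (inl g).
by rewrite !inE -ep (negPf np).
Qed.

Lemma card_gadget : #|gadget| = (quo m).+1.
Proof. by rewrite card_in_imset ?card_indices //; apply: gadget_edge_inj. Qed.

Lemma gadget_arity S : S \in gadget -> #|S| = k.
Proof.
case/imsetP => -[i l] /[!inE] /= li ->; rewrite card_sum_set.
have -> : [set x | inl x \in gadget_edge (i, l)] = if on_path (i, l) then pa i else pd i l.
  by apply/setP => g; rewrite !inE.
have [p|np] := boolP (on_path (i, l)); last first.
  rewrite card_pd //.
  have -> : [set y | inr y \in gadget_edge (i, l)] = [set i].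
    by apply/setP => w; rewrite !inE (negPf np) orbF.
  by rewrite cards1 addn1 prednK // ltnW.
rewrite card_pa //.
have i0 : (0 < i)%N by case/andP: p.
have x0 : (i.-1 < m)%N by apply: leq_ltn_trans (leq_pred _) (ltn_ord _).
have -> : [set y | inr y \in gadget_edge (i, l)] = [set i; Ordinal x0].
  by apply/setP => w; rewrite !inE p /= -!val_eqE /= -{2}(prednK i0) eqSS.
by rewrite cards2 -val_eqE /= -{1}(prednK i0) eqn_leq ltnn /= addn2; case: (k) k_ge2 => [|[]].
Qed.

Lemma gadget_new S : S \in gadget -> exists w, inr w \in S.
Proof. by case/imsetP => x _ ->; exists x.1; rewrite inE eqxx. Qed.

Lemma gadget_base S g : S \in gadget -> inl g \in S -> g \in D.
Proof.
case/imsetP => -[i l] /[!inE] /= li ->; rewrite inE; case: ifP => _ /=.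
  exact: subsetP (paD (ltn_ord i)) g.
exact: subsetP (pdD (ltn_ord i) li) g.
Qed.

Lemma gadget_cover d : d \in D -> exists2 S, S \in gadget & inl d \in S.
Proof.
move=> /cover[[i /andP[i0 im] di]|[i [l [im li il di]]]].
  exists (gadget_edge (Ordinal im, ord0)); last by rewrite inE /on_path /= i0.
  by apply: imset_f; rewrite inE /= /degree addn_gt0 subn_gt0 quo_lt.
have l2 : (l < (quo m).+2)%N by apply: leq_trans li _; rewrite leqW // degree_le.
exists (gadget_edge (Ordinal im, Ordinal l2)); first by apply: imset_f; rewrite inE.
rewrite inE /on_path /=; case/orP: il => [/eqP i0|l0]; first by rewrite i0 andbF -i0.
by rewrite (gtn_eqF l0).
Qed.

(** Charge each surviving edge to its highest new point. Point [i] keeps at most [degree i] edges,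
    one fewer if its predecessor is absent, which is the count of [sparse_sum]. *)
Lemma gadget_sparse (Z : {set G + 'I_m}) : ~~ [forall w, inr w \in Z] ->
  a * #|[set S in gadget | S \subset Z]|%:R <= #|[set w | inr w \in Z]|%:R.
Proof.
move=> /forallPn[w0 nw0].
pose P i := [exists w : 'I_m, (w == i :> nat) && (inr w \in Z)].
have PE (w : 'I_m) : P w = (inr w \in Z).
  apply/existsP/idP => [[w' /andP[/eqP/val_inj -> //]]|wZ]; exists w; rewrite eqxx //.
have ex : exists2 i, (i < m)%N & ~~ P i by exists w0; rewrite // PE.
have -> : #|[set w | inr w \in Z]| = (\sum_(i < m | P i) 1)%N.
  by rewrite -sum1_card; apply: eq_bigl => w; rewrite inE PE.
apply: le_trans (sparse_sum ex); rewrite ler_wpM2l ?(ltW a_gt0) // ler_nat.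
pose J := [set x in indices | gadget_edge x \subset Z].
apply: leq_trans (_ : #|J| <= _)%N.
  apply: leq_trans (leq_imset_card gadget_edge J); apply: subset_leq_card.
  apply/subsetP => S; rewrite inE => /andP[/imsetP[x xI ->] xZ].
  by apply: imset_f; rewrite inE xI.
rewrite -sum1_card.
rewrite (eq_bigl (fun x : index => xpredT x.1 && ((x.1, x.2) \in J))); last by case.
rewrite -(pair_big_dep xpredT (fun (i : 'I_m) (l : 'I_(quo m).+2) => (i, l) \in J)
  (fun _ _ => 1%N)) /=.
rewrite [X in (_ <= X)%N]big_mkcond /=; apply: leq_sum => i _.
have wZ (l : 'I_(quo m).+2) : (i, l) \in J -> inr i \in Z.
  by rewrite inE => /andP[_ /subsetP]; apply; rewrite inE eqxx.
case: ifP => Pi; last first.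
  by rewrite big1 // => l /wZ; rewrite -PE Pi.
have di : (degree i < (quo m).+2)%N by rewrite ltnS degree_le.
rewrite sum1_card.
pose c : nat := (0 < i)%N && ~~ P i.-1.
have lc (l : 'I_(quo m).+2) : (i, l) \in J -> (c <= l < degree i)%N.
  rewrite inE => /andP[+ /subsetP lZ]; rewrite inE /= => ->; rewrite andbT /c.
  case: (posnP l) => [l0|l0]; last by rewrite (leq_trans (leq_b1 _)).
  rewrite l0 leqn0 eqb0 negb_and negbK; apply/orP; case: (posnP i) => i0; first by left.
  right; have x0 : (i.-1 < m)%N by apply: leq_ltn_trans (leq_pred _) (ltn_ord _).
  rewrite (PE (Ordinal x0)); apply: lZ.
  by rewrite inE /on_path /= l0 i0 /= prednK // eqxx orbT.
apply: leq_trans (_ : size (iota c (degree i - c)) <= _)%N; last by rewrite size_iota.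
rewrite cardE -(size_map (val : 'I_(quo m).+2 -> nat)).
apply: uniq_leq_size; first by rewrite map_inj_uniq ?enum_uniq //; apply: val_inj.
move=> n /mapP[l]; rewrite mem_enum => /lc/andP[cl ld] ->.
by rewrite mem_iota cl subnKC // (leq_trans cl) // ltnW.
Qed.

(** Every base point lies on an edge, so at least one edge is lost, and the other [quo m] weigh at
    most [m]. *)
Lemma gadget_missing (Z : {set G + 'I_m}) d : d \in D -> inl d \notin Z ->
  a * #|[set S in gadget | S \subset Z]|%:R <= m%:R.
Proof.
move=> dD dZ; have [S0 S0g dS0] := gadget_cover dD.
have : (#|[set S in gadget | S \subset Z]| <= quo m)%N.
  rewrite -ltnS -card_gadget; apply: proper_card; apply/properP; split.
    by apply/subsetP => S; rewrite inE => /andP[].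
  by exists S0 => //; rewrite inE S0g; apply: contra dZ => /subsetP; apply.
rewrite -(ler_nat R) -(ler_pM2l a_gt0) => /le_trans; apply.
by have := rem_ge0 a_gt0 m; rewrite /wrem; lra.
Qed.

End Gadget.

(** * Placing the edges of a gadget on a given base *)

Section GadgetExists.
Variables (R : realType) (a : R) (a_gt0 : 0 < a) (a_le1 : a <= 1).
Local Notation rem := (wrem a).
Local Notation quo := (wquo a).

Lemma degree_bound m i : (degree a m i <= Num.trunc a^-1 + 2)%N.
Proof.
rewrite /degree [X in (_ <= X)%N]addnS -[X in (_ <= X)%N]addn1 leq_add //; last by case: eqP.
rewrite leq_subLR -ltnS -(ltr_nat R) -(ltr_pM2l a_gt0).
have h0 := rem_lt a_gt0 i; have h1 := rem_ge0 a_gt0 i.+1.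
have : 1 < a * (Num.trunc a^-1).+1%:R.
  by rewrite -ltr_pdivrMl // mulr1 truncnS_gt.
by move: h0 h1; rewrite /wrem addnA -!natr1 !natrD -!natr1; lra.
Qed.

(** The first [k - 2] base points lie on every edge with one new point, and its last place runs
    cyclically through the rest of the base; path edges are filled likewise with one point fewer. If
    [2 < k], path edges reach the whole cycle. If [k = 2] they contain no base point, and the other
    [quo m - m + 2] edges must be numerous, which requires [a < 1]. *)
Lemma gadget_exists (k n : nat) : (2 <= k)%N -> (2 < k)%N \/ a < 1 -> exists m0,
  forall (G : finType) (D : {set G}) m, (#|D| <= n)%N ->
  (k + Num.trunc a^-1 + 2 <= #|D|)%N -> (m0 <= m)%N -> (0 < m)%N ->
  (forall i, (0 < i < m)%N -> rem i <= rem m) ->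
  exists New : {set {set G + 'I_m}},
  [/\ forall S, S \in New -> #|S| = k /\ exists w, inr w \in S,
      forall S g, S \in New -> inl g \in S -> g \in D,
      #|New| = (quo m).+1,
      forall Z : {set G + 'I_m}, ~~ [forall w, inr w \in Z] ->
        a * #|[set S in New | S \subset Z]|%:R <= #|[set w | inr w \in Z]|%:R &
      forall (Z : {set G + 'I_m}) d, d \in D -> inl d \notin Z ->
        a * #|[set S in New | S \subset Z]|%:R <= m%:R].
Proof.
move=> k2 ka.
(* [m > n] lets the path edges go once round the cycle, and [m * (a^-1 - 1) > n] yields
   [quo m >= n + m]. For [a = 1] the quotient is 0 by the convention on division, and the case
   [2 < k] is in force. *)
exists (n + (Num.trunc (n%:R / (a^-1 - 1))).+2)%N => G D m Dn KD m0m m_gt0 rmax.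
pose e := enum D; have sz_e : size e = #|D| by rewrite cardE.
have [d0 d0D] : exists d, d \in D.
  by apply/set0Pn; rewrite -card_gt0; lia.
pose e1 := take k.-2 e; pose e2 := drop k.-2 e; pose n' := size e2.
have n'E : n' = (#|D| - k.-2)%N by rewrite /n' size_drop sz_e.
have ue : uniq e := enum_uniq _.
have : uniq (e1 ++ e2) by rewrite cat_take_drop.
rewrite cat_uniq => /and3P[ue1 /hasPn dis ue2].
have memD x : (x \in D) = (x \in e1) || (x \in e2).
  by rewrite -mem_cat cat_take_drop mem_enum.
pose el j := nth d0 e2 (j %% n').
have n'0 : (0 < n')%N by lia.
have el2 j : el j \in e2 by rewrite mem_nth // ltn_mod.
have el1 j : el j \notin e1 by apply: dis.
pose pd i l := el (quo i - i + l)%N |: [set x in e1].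
pose pa (i : nat) := if k == 2%N then set0 else el i |: [set x in take k.-2.-1 e].
have sub1 : {subset take k.-2.-1 e <= e1}.
  move=> x; rewrite -(take_takel _ (leq_pred k.-2)); exact: mem_take.
have card_set_uniq (s : seq G) : uniq s -> #|[set x in s]| = size s.
  by move=> us; rewrite -(card_uniqP us); apply: eq_card => x; rewrite inE.
have size1 : size e1 = k.-2 by rewrite size_take sz_e; case: ltnP => //; lia.
have card_pd i l : #|pd i l| = k.-1.
  by rewrite cardsU1 inE el1 card_set_uniq // size1; lia.
have card_pa i : #|pa i| = k.-2.
  rewrite /pa; case: eqP => [->|/eqP kn2]; first by rewrite cards0.
  rewrite cardsU1 inE card_set_uniq ?take_uniq // size_take sz_e.
  have -> /= : el i \notin take k.-2.-1 e by apply: contra (el1 i) => /sub1.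
  by case: ltnP => h; lia.
have pdD i l : pd i l \subset D.
  apply/subsetP => x; rewrite !inE memD => /orP[/eqP ->|->] //.
  by rewrite el2 orbT.
have paD i : pa i \subset D.
  rewrite /pa; case: ifP => _; first exact: sub0set.
  apply/subsetP => x; rewrite !inE memD => /orP[/eqP ->|/sub1 ->] //.
  by rewrite el2 orbT.
have pd_inj i l l' : (l < degree a m i)%N -> (l' < degree a m i)%N -> pd i l = pd i l' -> l = l'.
  move=> li li' E; have : el (quo i - i + l)%N \in pd i l' by rewrite -E !inE eqxx.
  rewrite !inE (negPf (el1 _)) orbF nth_uniq ?ltn_mod // eqn_modDl.
  have db := degree_bound m i.
  by rewrite !modn_small; first (by move/eqP); lia.
have quo_ge i : (i <= quo i)%N.
  by elim: i => // i IH; apply: leq_ltn_trans IH (quo_lt a_gt0 a_le1 i).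
(* Path edges aside, point 0 uses the positions below [quo 1] and point [i > 0] those from
   [quo i - i + 1] to [quo i.+1 - i.+1], so consecutive points continue each other without a gap. *)
have pendants i : (0 < i <= m)%N -> forall j, (j <= quo i - i)%N ->
    exists i' l, [/\ (i' < m)%N, (l < degree a m i')%N, (i' == 0)%N || (0 < l)%N &
      j = (quo i' - i' + l)%N].
  elim: i => // i IH /andP[_ im] j ji.
  have [i0|i_gt0] := posnP i.
    exists 0%N, j; rewrite i0 in ji; split=> //.
      by rewrite /degree (proj1 (quo0 a_gt0)); have := quo_ge 1%N; lia.
    by rewrite (proj1 (quo0 a_gt0)).
  have [jle|jgt] := leqP j (quo i - i); first by apply: (IH _ j jle); rewrite i_gt0 ltnW.
  exists i, (j - (quo i - i))%N; split=> //; first 2 [by lia].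
  - by rewrite /degree; have := quo_ge i; have := quo_ge i.+1; lia.
  by rewrite subnKC // ltnW.
have cover d : d \in D ->
  (exists2 i, (0 < i < m)%N & d \in pa i) \/
  (exists i l, [/\ (i < m)%N, (l < degree a m i)%N, (i == 0)%N || (0 < l)%N & d \in pd i l]).
  rewrite memD => /orP[d1|d2].
    (* The extra edge gives the last point at least two edges, so number 1 exists there, and it is
       not a path edge. *)
    right; exists m.-1, 1%N; split; rewrite ?orbT //; first by lia.
      have q0 := quo_lt a_gt0 a_le1 m.-1.
      by rewrite /degree prednK // eqxx addn1 ltnS subn_gt0 -{2}(prednK m_gt0).
    by rewrite /pd !inE d1 orbT.
  have [j jn' dj] : exists2 j, (j < n')%N & d = el j.
    exists (index d e2); first by rewrite index_mem.
    by rewrite /el modn_small ?index_mem // nth_index.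
  have [k3|k3] := ltnP 2 k.
    (* Point 0 has no path edge; [n'] represents the same place of the cycle. *)
    left; exists (if j == 0%N then n' else j); first by case: ifP; lia.
    rewrite /pa gtn_eqF // !inE dj; case: (j =P 0%N) => [->|_]; last by rewrite eqxx.
    by rewrite /el modnn mod0n eqxx.
  have a1 : a < 1 by case: ka => //; lia.
  right; case: (pendants m _ j); first by rewrite m_gt0 leqnn.
    have c0 : 0 < a^-1 - 1 by rewrite subr_gt0 invf_gt1.
    have : n%:R / (a^-1 - 1) < m%:R.
      apply: lt_le_trans (truncnS_gt _) _; rewrite ler_nat.
      by move: m0m; set t := Num.trunc _; lia.
    rewrite ltr_pdivrMr // => nm.
    suff : (n + m <= quo m)%N by lia.
    rewrite -ltnS -(ltr_nat R) -(ltr_pM2l a_gt0) -natr1 natrD.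
    have := rem_lt a_gt0 m; rewrite /wrem.
    suff : a * (n%:R + m%:R) < m%:R by lra.
    have e' : m%:R = a * (m%:R * (a^-1 - 1) + m%:R).
      by rewrite mulrBr mulr1 subrK mulrCA mulfV ?mulr1 // gt_eqF.
    by rewrite [X in _ < X]e' ltr_pM2l // ltrD2r.
  move=> i [l [im li il ej]]; exists i, l; split=> //.
  by rewrite dj /pd ej !inE eqxx.
have pd_inj' i l l' : (i < m)%N -> (l < degree a m i)%N -> (l' < degree a m i)%N ->
  pd i l = pd i l' -> l = l' by move=> _; apply: pd_inj.
exists (gadget a m pa pd); split.
- move=> S Sg; split; last exact: gadget_new Sg.
  by apply: (gadget_arity k2 _ _ Sg) => *.
- by move=> S g; apply: gadget_base => *.
- by apply: (card_gadget a_gt0 a_le1 m_gt0 pa pd_inj').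
- by move=> Z; apply: gadget_sparse.
- by move=> Z d; apply: (gadget_missing a_gt0 a_le1 m_gt0 pd_inj' cover).
Qed.

End GadgetExists.

(** * Adding points and edges of one symbol to a structure *)

Section Extension.
Variables (L : finType) (ar : L -> nat).

(** Two injective enumerations of the same set differ by a permutation, so in [inKL] a relation
    amounts to a family of sets. *)
Lemma frel_holds_on (A : finLstr ar) E (a : {ffun 'I_(ar E) -> fdom A}) :
  inKL A -> Defs.frel a <-> injective a /\ holds_on E [set a k | k : 'I_(ar E)].
Proof.
move=> AK; split=> [h|[a_inj /existsP[b /andP[/eqP eab hb]]]].
  by split; [have [] := AK E a h | apply/existsP; exists a; rewrite eqxx].
have [b_inj perm] := AK E b hb.
have ex k : exists j, b j == a k.
  have : a k \in [set b k | k : 'I_(ar E)] by rewrite -eab imset_f.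
  by case/imsetP => j _ ->; exists j.
pose p k := xchoose (ex k).
have bp k : b (p k) = a k by apply/eqP/(xchooseP (ex k)).
have p_inj : injective p by move=> x y e; apply: a_inj; rewrite -!bp e.
have := perm p (injF_bij p_inj); congr is_true; congr Defs.frel.
by apply/ffunP => k; rewrite ffunE bp.
Qed.

Variables (A : finLstr ar) (W : finType) (E0 : L) (New : {set {set fdom A + W}}).

Definition extension : finLstr ar :=
  FinLstr (fun E (a : {ffun 'I_(ar E) -> fdom A + W}) =>
    injectiveb a &&
    ([exists S : {set fdom A}, holds_on E S && ([set a k | k : 'I_(ar E)] == inl @: S)] ||
     (E == E0) && ([set a k | k : 'I_(ar E)] \in New))).

Hypothesis AK : inKL A.
Hypothesis New_arity : forall S, S \in New -> #|S| = ar E0.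
Hypothesis New_inr : forall S, S \in New -> exists w, inr w \in S.

Lemma extension_inKL : inKL extension.
Proof.
move=> E a /andP[/injectiveP a_inj h]; split=> // p p_bij.
have p_inj := bij_inj p_bij.
apply/andP; split; first by apply/injectiveP => x y; rewrite !ffunE => /a_inj/p_inj.
have -> // : [set [ffun k => a (p k)] k | k : 'I_(ar E)] = [set a k | k : 'I_(ar E)].
have [q _ qK] := p_bij.
apply/setP => z; apply/imsetP/imsetP => -[k _ ->].
  by exists (p k); rewrite ?ffunE.
by exists (q k); rewrite // ffunE qK.
Qed.

Lemma extension_holds_on E (Z : {set fdom extension}) : holds_on E Z =
  [exists S : {set fdom A}, holds_on E S && (Z == inl @: S)] || (E == E0) && (Z \in New).
Proof.
apply/existsP/idP => [[a /andP[/eqP -> /andP[_ //]]]|].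
case/orP => [/existsP[S /andP[/existsP[a /andP[/eqP eS ha]] /eqP ->]]|/andP[/eqP EE ZN]].
  have [a_inj _] := AK ha.
  exists [ffun k => inl (a k)].
  have e : [set [ffun k => inl (a k) : fdom A + W] k | k : 'I_(ar E)] = inl @: S.
    by rewrite eS -imset_comp; apply: eq_imset => k; rewrite /= ffunE.
  rewrite e eqxx /= e; apply/andP; split.
    by apply/injectiveP => x y; rewrite !ffunE => -[/a_inj].
  apply/orP; left; apply/existsP; exists S; rewrite eqxx andbT.
  by apply/existsP; exists a; rewrite eS eqxx.
have cZ : ar E = #|Z| by rewrite EE New_arity.
exists [ffun k => enum_val (cast_ord cZ k)].
have e : [set [ffun k => enum_val (cast_ord cZ k) : fdom A + W] k | k : 'I_(ar E)] = Z.
  apply/setP => z; apply/imsetP/idP => [[k _ ->]|zZ].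
    by rewrite ffunE enum_valP.
  exists (cast_ord (esym cZ) (enum_rank_in zZ z)) => //.
  by rewrite ffunE cast_ordKV enum_rankK_in.
rewrite e eqxx /= e ZN (introT eqP EE) orbT andbT; apply/injectiveP => x y.
by rewrite !ffunE => /enum_val_inj/cast_ord_inj.
Qed.

Lemma imset_inl_notin (S : {set fdom A}) : inl @: S \notin New.
Proof. by apply/negP => /New_inr[w /imsetP[]]. Qed.

Lemma extension_emb : emb (M := toL extension) (inl : fdom A -> fdom extension).
Proof.
apply/emb_toLP; split=> [|E a]; first exact: inl_inj.
have e : [set [ffun k => inl (a k) : fdom A + W] k | k : 'I_(ar E)] =
    inl @: [set a k | k : 'I_(ar E)].
  by rewrite -imset_comp; apply: eq_imset => k; rewrite /= ffunE.
apply/idP/idP => [/(frel_holds_on _ AK)[a_inj h]|/andP[/injectiveP a_inj]].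
  apply/andP; split.
    by apply/injectiveP => x y; rewrite !ffunE => -[/a_inj].
  apply/orP; left; apply/existsP; exists [set a k | k : 'I_(ar E)].
  by rewrite h e eqxx.
rewrite e (negPf (imset_inl_notin _)) andbF orbF => /existsP[S /andP[hS /eqP/imset_inj eS]].
apply/frel_holds_on => //; split; last by rewrite eS //; apply: inl_inj.
by move=> x y axy; apply: a_inj; rewrite !ffunE axy.
Qed.

Variables (R : realType) (alpha : L -> R).

Lemma extension_deltaS (Z : {set fdom extension}) :
  deltaS alpha Z = deltaS alpha [set x | inl x \in Z] + #|[set w | inr w \in Z]|%:R
    - alpha E0 * #|[set S in New | S \subset Z]|%:R.
Proof.
rewrite /deltaS card_sum_set natrD.
have N E : Nset E Z = (Nset E [set x | inl x \in Z] +
    (E == E0) * #|[set S in New | S \subset Z]|)%N.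
  rewrite /Nset -(card_imset _ (imset_inj (@inl_inj (fdom A) W))).
  set P := [set S : {set fdom extension} | _]; set Q := imset _ _.
  pose T : {set {set fdom extension}} := [set S in New | (S \subset Z) && (E == E0)].
  have -> : ((E == E0) * #|[set S in New | S \subset Z]|)%N = #|T|.
    case: eqP => EE; rewrite ?mul1n ?mul0n.
      by apply: eq_card => S; rewrite !inE EE eqxx andbT.
    by rewrite eq_card0 // => S; rewrite !inE (introF eqP EE) !andbF.
  have QT : Q :&: T = set0.
    apply/setP => S; rewrite !inE; apply/negP => /andP[/imsetP[S0 _ ->]].
    by rewrite (negPf (imset_inl_notin _)).
  rewrite -cardsUI QT cards0 addn0; apply: eq_card => S.
  rewrite !inE extension_holds_on andb_orr; congr orb; last first.
    by rewrite andbC -andbA andbC -andbA.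
  apply/andP/imsetP => [[SZ /existsP[S0 /andP[h /eqP eS]]]|[S0 /[!inE] /andP[S0Z h] ->]].
    exists S0 => //; rewrite inE h andbT; apply/subsetP => x xS.
    by rewrite inE (subsetP SZ) // eS imset_f.
  split; last by apply/existsP; exists S0; rewrite h eqxx.
  by apply/subsetP => _ /imsetP[x /(subsetP S0Z) /[!inE] xZ ->].
under eq_bigr => E _ do rewrite N natrD mulrDr.
rewrite big_split /= [X in _ - (_ + X)](bigD1 E0) //= eqxx mul1n.
rewrite [X in _ - (_ + (_ + X))]big1 => [|E /negPf ->]; last by rewrite mul0n mulr0.
ring.
Qed.

End Extension.

(** * Extensions with delta close to that of a closed subset *)

Section LowerDelta.
Variables (L : finType) (ar : L -> nat) (R : realType) (alpha : L -> R).
Hypothesis ar_ge2 : forall E, (2 <= ar E)%N.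
Hypothesis alpha_gt0 : forall E, 0 < alpha E.
Hypothesis alpha_le1 : forall E, alpha E <= 1.
Local Notation deltaS := (deltaS alpha).

(* [D0] is to stay [r]-closed, [t] is the part of delta above [C] that is still to be
   removed, and [D] is the base for gadgets: supersets of [C :|: D] can afford to lose
   [t], while a gadget costs nothing to a set that misses a point of [D]. *)
Record good (r : nat) (G : finLstr ar) (C D0 D : {set fdom G}) (t : R) : Prop := Good {
  good_K : inKalpha alpha G;
  good_D : D0 \subset D;
  good_le : forall Z : {set fdom G}, C \subset Z -> deltaS C <= deltaS Z;
  good_closed : forall Z : {set fdom G}, D0 \subset Z -> (#|Z| <= #|D0| + r)%N ->
    deltaS D0 <= deltaS Z;
  good_base : forall Z : {set fdom G}, C :|: D \subset Z -> deltaS C + t <= deltaS Z;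
  good_total : deltaS [set: fdom G] = deltaS C + t
}.

(** By submodularity delta of [X] is at least delta of [X :&: C] plus the difference between
    [X :|: C] and [C]; both terms are non-negative. *)
Lemma inKalpha_le (A : finLstr ar) (C : {set fdom A}) : inKL A ->
  (forall Z : {set fdom A}, C \subset Z -> deltaS C <= deltaS Z) ->
  (forall Z : {set fdom A}, Z \subset C -> 0 <= deltaS Z) -> inKalpha alpha A.
Proof.
move=> AK up down; split=> // X.
have := deltaS_submod alpha_gt0 X C.
have := up (X :|: C) (subsetUr _ _); have := down (X :&: C) (subsetIr _ _); lra.
Qed.

Variable r : nat.

(** One point is added, on one edge into [D] or on none. It joins the base, because a set avoiding
    it has not gained the increase of [t]. *)
Lemma good_up (G : finLstr ar) C D0 D t (b : bool) E :
  good r (G := G) C D0 D t -> (ar E <= #|D|.+1)%N ->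
  exists (G' : finLstr ar) (j : fdom G -> fdom G') (D' : {set fdom G'}),
  [/\ emb (M := toL G') j,
      good r (j @: C) (j @: D0) D' (t + (1 - b%:R * alpha E)),
      #|fdom G'| = #|fdom G|.+1 & #|D'| = #|D|.+1].
Proof.
move=> gG arD; have [GK D0D gle gcl gb gt] := gG; have [GKL G0] := GK.
pose P := [set x in take (ar E).-1 (enum D)].
have cP : #|P| = (ar E).-1.
  rewrite -[RHS](_ : size (take (ar E).-1 (enum D)) = _); last first.
    by rewrite size_takel // -cardE; have := ar_ge2 E; lia.
  by rewrite -(card_uniqP (take_uniq _ (enum_uniq _))); apply: eq_card => x; rewrite inE.
pose S0 : {set fdom G + unit} := inr tt |: (inl @: P).
pose New : {set {set fdom G + unit}} := if b then [set S0] else set0.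
have NewS S : S \in New -> b /\ S = S0.
  by rewrite /New; case: (b); rewrite !inE // => /eqP.
have New_arity S : S \in New -> #|S| = ar E.
  case/NewS => _ ->; rewrite cardsU1 card_imset; last exact: inl_inj.
  have -> : inr tt \notin ([set inl x | x in P] : {set fdom G + unit}).
    by apply/imsetP => -[].
  by rewrite cP; have := ar_ge2 E; rewrite add1n; case: (ar E).
have New_inr S : S \in New -> exists w, inr w \in S.
  by case/NewS => _ ->; exists tt; rewrite !inE eqxx.
pose G' := extension E New; pose j : fdom G -> fdom G' := inl.
have jE : emb (M := toL G') j by apply: extension_emb.
have dZ := extension_deltaS GKL New_arity New_inr alpha.
have cN (Z : {set fdom G'}) :
    (#|[set S in New | S \subset Z]| <= b * (inr tt \in Z))%N.
  have [bZ|nbZ] := boolP (b && (inr tt \in Z)).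
    apply: leq_trans (_ : #|New| <= _)%N.
      by apply: subset_leq_card; apply/subsetP => S; rewrite inE => /andP[].
    by case/andP: bZ => bT ->; rewrite /New bT cards1.
  rewrite (_ : [set S in New | S \subset Z] = set0) ?cards0 //.
  apply/setP => S; rewrite !inE; apply/negP => /andP[/NewS[bT ->] /subsetP h].
  by case/negP: nbZ; rewrite bT h // !inE eqxx.
have cr (Z : {set fdom G'}) : #|[set w : unit | inr w \in Z]| = (inr tt \in Z) :> nat.
  have [h|h] := boolP (inr tt \in Z).
    by rewrite -[RHS]card_unit; apply: eq_card => -[]; rewrite !inE h.
  by apply: eq_card0 => -[]; rewrite !inE (negPf h).
have ge1 (Z : {set fdom G'}) : deltaS [set x | inl x \in Z] +
    (inr tt \in Z)%:R * (1 - b%:R * alpha E) <= deltaS Z.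
  have : alpha E * #|[set S in New | S \subset Z]|%:R <= (inr tt \in Z)%:R * (b%:R * alpha E).
    by rewrite mulrA mulrC -natrM ler_wpM2r ?(ltW (alpha_gt0 E)) // ler_nat mulnC; apply: cN.
  by rewrite dZ cr mulrBr mulr1; lra.
have w0 : 0 <= 1 - b%:R * alpha E.
  by case: (b); rewrite ?mul1r ?mul0r ?subr0 // subr_ge0.
have ge0 (Z : {set fdom G'}) : deltaS [set x | inl x \in Z] <= deltaS Z.
  by apply: le_trans (ge1 Z); rewrite lerDl mulr_ge0.
have sub (X : {set fdom G}) (Z : {set fdom G'}) :
    j @: X \subset Z -> X \subset [set x | inl x \in Z].
  by move=> /subsetP h; apply/subsetP => x xX; rewrite inE h // imset_f.
have dj (X : {set fdom G}) : deltaS (j @: X) = deltaS X by apply: deltaS_emb.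
have leC (Z : {set fdom G'}) : j @: C \subset Z -> deltaS (j @: C) <= deltaS Z.
  by move=> /sub CZ; rewrite dj; apply: le_trans (gle _ CZ) (ge0 Z).
exists G', j, (inr tt |: j @: D); split=> //.
- split=> //.
  + apply: (inKalpha_le (C := j @: C)) => //; first exact: extension_inKL.
    by move=> Z /subset_imsetP[Z0 _ ->]; rewrite dj.
  + exact: subset_trans (imsetS _ D0D) (subsetUr _ _).
  + move=> Z D0Z; rewrite card_imset; last exact: inl_inj.
    rewrite card_sum_set => cZ; rewrite dj; apply: le_trans (ge0 Z).
    by apply: gcl (sub _ _ D0Z) _; apply: leq_trans cZ; apply: leq_addr.
  + move=> Z; rewrite setUCA subUset sub1set => /andP[iZ].
    rewrite -imsetU => /sub h; apply: le_trans (ge1 Z).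
    by rewrite iZ mul1r dj; have := gb _ h; lra.
  rewrite dZ cr in_setT dj.
  have -> : [set x | inl x \in [set: fdom G']] = [set: fdom G] by apply/setP => x; rewrite !inE.
  have -> : #|[set S in New | S \subset [set: fdom G']]| = b.
    rewrite /New; case: (b); last by apply: eq_card0 => S; rewrite !inE.
    by rewrite -[RHS]/1%N -(cards1 S0); apply: eq_card => S; rewrite !inE subsetT andbT.
  by rewrite gt (_ : true%:R = 1 :> R) //; ring.
- by rewrite card_sum card_unit addn1.
rewrite cardsU1 card_imset; last exact: inl_inj.
have -> // : inr tt \notin [set j x | x in D].
by apply/imsetP => -[].
Qed.

(** Only a set containing [D] and all [m] new points loses delta, by at most [eta]. If it contains
    [C], the reserve [t] pays; if it is a small extension of [D0], [r < m] prevents it from holding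
    all new points. *)
Lemma good_down (G : finLstr ar) C D0 D t E m (New : {set {set fdom G + 'I_m}}) eta :
  good r (G := G) C D0 D t -> (r < m)%N -> 0 <= eta <= t ->
  eta = alpha E * #|New|%:R - m%:R ->
  (forall S, S \in New -> #|S| = ar E /\ exists w, inr w \in S) ->
  (forall S g, S \in New -> inl g \in S -> g \in D) ->
  (forall Z : {set fdom G + 'I_m}, ~~ [forall w, inr w \in Z] ->
        alpha E * #|[set S in New | S \subset Z]|%:R <= #|[set w | inr w \in Z]|%:R) ->
  (forall (Z : {set fdom G + 'I_m}) d, d \in D -> inl d \notin Z ->
        alpha E * #|[set S in New | S \subset Z]|%:R <= m%:R) ->
  exists (G' : finLstr ar) (j : fdom G -> fdom G'),
  [/\ emb (M := toL G') j,
      good r (j @: C) (j @: D0) (j @: D) (t - eta) &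
      #|fdom G'| = (#|fdom G| + m)%N].
Proof.
move=> gG rm /andP[eta0 etat] etaE New_E New_D sparse missing.
have [GK D0D gle gcl gb gt] := gG; have [GKL G0] := GK.
have New_arity S : S \in New -> #|S| = ar E by move=> /New_E[].
have New_inr S : S \in New -> exists w, inr w \in S by move=> /New_E[].
pose G' := extension E New; pose j : fdom G -> fdom G' := inl.
have jE : emb (M := toL G') j by apply: extension_emb.
have dZ := extension_deltaS GKL New_arity New_inr alpha.
have sub (X : {set fdom G}) (Z : {set fdom G'}) :
    j @: X \subset Z -> X \subset [set x | inl x \in Z].
  by move=> /subsetP h; apply/subsetP => x xX; rewrite inE h // imset_f.
have dj (X : {set fdom G}) : deltaS (j @: X) = deltaS X by apply: deltaS_emb.
have full (Z : {set fdom G'}) : [forall w, inr w \in Z] -> #|[set w | inr w \in Z]| = m.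
  move=> /forallP h; rewrite -[RHS](card_ord m); apply: eq_card => w.
  by rewrite !inE h.
have ge0 (Z : {set fdom G'}) : ~~ [forall w, inr w \in Z] || ~~ (D \subset [set x | inl x \in Z]) ->
    deltaS [set x | inl x \in Z] <= deltaS Z.
  move=> h; rewrite dZ -addrA lerDl subr_ge0.
  have [fZ|nf] := boolP [forall w, inr w \in Z]; last exact: sparse.
  move: h; rewrite fZ (full _ fZ) => /subsetPn[d dD]; rewrite inE => dZ'.
  exact: missing dD dZ'.
have geeta (Z : {set fdom G'}) : [forall w, inr w \in Z] ->
    deltaS [set x | inl x \in Z] - eta <= deltaS Z.
  move=> /full cm; rewrite dZ cm etaE.
  have : alpha E * #|[set S in New | S \subset Z]|%:R <= alpha E * #|New|%:R.
    rewrite ler_wpM2l ?(ltW (alpha_gt0 E)) // ler_nat; apply: subset_leq_card.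
    by apply/subsetP => S; rewrite inE => /andP[].
  lra.
have leC (Z : {set fdom G'}) : j @: C \subset Z -> deltaS (j @: C) <= deltaS Z.
  move=> /sub CZ; rewrite dj.
  have [h|] := boolP (~~ [forall w, inr w \in Z] || ~~ (D \subset [set x | inl x \in Z])).
    exact: le_trans (gle _ CZ) (ge0 _ h).
  rewrite negb_or !negbK => /andP[/geeta le DZ].
  have := gb [set x | inl x \in Z]; rewrite subUset CZ DZ => /(_ isT); lra.
have eta_full (Z : {set fdom G'}) : j @: (C :|: D) \subset Z -> deltaS C + (t - eta) <= deltaS Z.
  move=> /sub CDZ; have h := gb _ CDZ.
  have [fZ|nf] := boolP [forall w, inr w \in Z]; first by have := geeta _ fZ; lra.
  by have := ge0 Z; rewrite nf => /(_ isT); lra.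
exists G', j; split=> //; last by rewrite card_sum card_ord.
split=> //.
- apply: (inKalpha_le (C := j @: C)) => //; first exact: extension_inKL.
  by move=> Z /subset_imsetP[Z0 _ ->]; rewrite dj.
- exact: imsetS.
- move=> Z D0Z; rewrite card_imset; last exact: inl_inj.
  rewrite card_sum_set => cZ; rewrite dj.
  apply: le_trans (ge0 Z _).
    by apply: gcl (sub _ _ D0Z) _; apply: leq_trans cZ; apply: leq_addr.
  apply/orP; left; apply/negP => /full cm; move: cZ; rewrite cm leqNgt => /negP; apply.
  rewrite -addnS leq_add // subset_leq_card //; exact: sub.
- by move=> Z; rewrite -imsetU dj; apply: eta_full.
rewrite dj dZ.
have -> : [set x | inl x \in [set: fdom G']] = [set: fdom G] by apply/setP => x; rewrite !inE.
rewrite full; last by apply/forallP => w; rewrite inE.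
have -> : [set S in New | S \subset [set: fdom G']] = New.
  by apply/setP => S; rewrite !inE subsetT andbT.
by rewrite gt etaE; ring.
Qed.

(** * Bookkeeping for repeated extension steps *)

(** Of the enlarged structure only three numbers are kept: added points [n], size [d] of the base
    and excess [t]. *)
Definition reach (G : finLstr ar) (C D0 : {set fdom G}) (n d : nat) (t : R) : Prop :=
  exists (G' : finLstr ar) (j : fdom G -> fdom G') (D' : {set fdom G'}),
  [/\ emb (M := toL G') j, good r (j @: C) (j @: D0) D' t,
      #|fdom G'| = (#|fdom G| + n)%N & #|D'| = d].

Section Reach.
Variables (G : finLstr ar) (C D0 : {set fdom G}).

Lemma reach_up n d t (b : bool) E : reach C D0 n d t -> (ar E <= d.+1)%N ->
  reach C D0 n.+1 d.+1 (t + (1 - b%:R * alpha E)).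
Proof.
move=> [G1 [j [D' [jE g1 cG1 cD']]]] Ed; rewrite -cD' in Ed.
have [G2 [j2 [D2 [j2E g2 cG2 cD2]]]] := good_up b g1 Ed.
exists G2, (fun x => j2 (j x)), D2; split=> //.
- exact: (emb_comp (M := toL G2) jE j2E).
- by move: g2; rewrite -!imset_comp.
- by rewrite cG2 cG1 addnS.
by rewrite cD2 cD'.
Qed.

Lemma reach_ups n d t (b : bool) E k : reach C D0 n d t -> (ar E <= d.+1)%N ->
  reach C D0 (n + k) (d + k) (t + k%:R * (1 - b%:R * alpha E)).
Proof.
move=> h Ed; elim: k => [|k IH]; first by rewrite !addn0 mul0r addr0.
rewrite !addnS -natr1 mulrDl mul1r addrA; apply: reach_up IH _.
by rewrite (leq_trans Ed) // ltnS leq_addr.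
Qed.

Lemma reach_down n d t E m eta : reach C D0 n d t -> (r < m)%N -> 0 <= eta <= t ->
  eta = alpha E - wrem (alpha E) m ->
  (forall (T : finType) (D : {set T}), #|D| = d -> exists New : {set {set T + 'I_m}},
    [/\ forall S, S \in New -> #|S| = ar E /\ exists w, inr w \in S,
      forall S g, S \in New -> inl g \in S -> g \in D,
      #|New| = (wquo (alpha E) m).+1,
      forall Z : {set T + 'I_m}, ~~ [forall w, inr w \in Z] ->
        alpha E * #|[set S in New | S \subset Z]|%:R <= #|[set w | inr w \in Z]|%:R &
      forall (Z : {set T + 'I_m}) d, d \in D -> inl d \notin Z ->
        alpha E * #|[set S in New | S \subset Z]|%:R <= m%:R]) ->
  reach C D0 (n + m) d (t - eta).
Proof.
move=> [G1 [j [D' [jE g1 cG1 cD']]]] rm et etaE gad.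
have [New [N1 N2 N3 N4 N5]] := gad _ _ cD'.
have eE : eta = alpha E * #|New|%:R - m%:R.
  by rewrite etaE N3 /wrem -natr1; ring.
have [G2 [j2 [j2E g2 cG2]]] := good_down g1 rm et eE N1 N2 N4 N5.
exists G2, (fun x => j2 (j x)), (j2 @: D'); split=> //.
- exact: (emb_comp (M := toL G2) jE j2E).
- by move: g2; rewrite -!imset_comp.
- by rewrite cG2 cG1 addnA.
by rewrite card_imset // ; case: j2E.
Qed.

Lemma reach_downs n d t E m eta k : reach C D0 n d t -> (r < m)%N -> 0 <= eta ->
  k%:R * eta <= t -> eta = alpha E - wrem (alpha E) m ->
  (forall (T : finType) (D : {set T}), #|D| = d -> exists New : {set {set T + 'I_m}},
    [/\ forall S, S \in New -> #|S| = ar E /\ exists w, inr w \in S,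
      forall S g, S \in New -> inl g \in S -> g \in D,
      #|New| = (wquo (alpha E) m).+1,
      forall Z : {set T + 'I_m}, ~~ [forall w, inr w \in Z] ->
        alpha E * #|[set S in New | S \subset Z]|%:R <= #|[set w | inr w \in Z]|%:R &
      forall (Z : {set T + 'I_m}) d, d \in D -> inl d \notin Z ->
        alpha E * #|[set S in New | S \subset Z]|%:R <= m%:R]) ->
  reach C D0 (n + k * m) d (t - k%:R * eta).
Proof.
move=> h rm e0 + eE gad; elim: k => [|k IH]; first by rewrite addn0 mul0r subr0.
rewrite -natr1 => kt; rewrite mulSnr addnA mulrDl mul1r opprD addrA.
apply: (reach_down (IH _) rm _ eE gad); first by lra.
by rewrite e0 /=; lra.
Qed.

Hypothesis GK : inKalpha alpha G.
Hypothesis CD : C :|: D0 = setT.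
Hypothesis C_le : forall Z : {set fdom G}, C \subset Z -> deltaS C <= deltaS Z.
Hypothesis D0_closed : forall Z : {set fdom G}, D0 \subset Z -> (#|Z| <= #|D0| + r)%N ->
    deltaS D0 <= deltaS Z.

Lemma reach_start : reach C D0 0 #|D0| (deltaS [set: fdom G] - deltaS C).
Proof.
exists G, id, D0; rewrite !imset_id; split=> //; last by rewrite addn0.
  exact: emb_id.
split=> // [Z|]; last by lra.
by rewrite CD subTset => /eqP ->; lra.
Qed.

(** Submodularity on [C] and [D0], whose union is everything. The upper bound is independent of [C],
    and so is the number of gadgets needed. *)
Lemma residual_bounds : 0 <= deltaS [set: fdom G] - deltaS C <= #|D0|%:R.
Proof.
have := deltaS_submod alpha_gt0 C D0; rewrite CD.
have := C_le (subsetT C); have := deltaS_le_card alpha_gt0 D0.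
by have := GK.2 (C :&: D0); lra.
Qed.

Lemma reach_end n d t : reach C D0 n d t ->
  exists (G' : finLstr ar) (j : fdom G -> fdom G'),
  [/\ emb (M := toL G') j /\ inKalpha alpha G',
      #|fdom G'| = (#|fdom G| + n)%N,
      forall Z : {set fdom G'}, j @: C \subset Z -> deltaS (j @: C) <= deltaS Z,
      forall Z : {set fdom G'}, j @: D0 \subset Z -> (#|Z| <= #|D0| + r)%N ->
        deltaS (j @: D0) <= deltaS Z &
      deltaS [set: fdom G'] = deltaS (j @: C) + t].
Proof.
move=> [G' [j [D' [jE [GK' _ h1 h2 _ h3] cG' _]]]]; exists G', j; split=> //.
by move=> Z h; rewrite -(card_imset D0 (proj1 jE)); apply: h2.
Qed.

End Reach.
(** A sum over all symbols, so that one size of base admits gadgets of every symbol. *)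
Definition base_size : nat := \sum_E (ar E + Num.trunc (alpha E)^-1 + 2).

Lemma base_size_ge E : (ar E + Num.trunc (alpha E)^-1 + 2 <= base_size)%N.
Proof. by rewrite /base_size (bigD1 E) //= leq_addr. Qed.

Hypothesis nondegenerate : ~ ((forall E, ar E = 2%N) /\ (forall E, alpha E = 1)).

(* If some [alpha E] is irrational, there are gadgets of delta in [(-eps, 0)].  If all
   are rational, gadgets of one symbol lower delta by a fixed [eta], and new points on
   at most one edge first bring the excess to a multiple of [eta]. *)
Lemma lower_delta eps s : 0 < eps -> exists e : nat, forall (G : finLstr ar) (C D0 : {set fdom G}),
  inKalpha alpha G -> C :|: D0 = setT ->
  (forall Z : {set fdom G}, C \subset Z -> deltaS C <= deltaS Z) ->
  (forall Z : {set fdom G}, D0 \subset Z -> (#|Z| <= #|D0| + r)%N -> deltaS D0 <= deltaS Z) ->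
  (base_size <= #|D0| <= s)%N ->
  exists (G' : finLstr ar) (j : fdom G -> fdom G'),
  [/\ emb (M := toL G') j /\ inKalpha alpha G',
      (#|fdom G'| <= #|fdom G| + e)%N,
      forall Z : {set fdom G'}, j @: C \subset Z -> deltaS (j @: C) <= deltaS Z,
      forall Z : {set fdom G'}, j @: D0 \subset Z -> (#|Z| <= #|D0| + r)%N ->
        deltaS (j @: D0) <= deltaS Z &
      deltaS [set: fdom G'] < deltaS (j @: C) + eps].
Proof.
move=> eps0.
have [[E irr]|rat] := pselect (exists E, forall i q : nat, (0 < i)%N -> i%:R <> alpha E * q%:R).
  have a1 : alpha E < 1.
    rewrite lt_neqAle alpha_le1 andbT; apply/eqP => a1.
    by apply: (irr 1%N 1%N) => //; rewrite a1 mulr1.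
  have [m0 gad] := gadget_exists (alpha_gt0 E) (alpha_le1 E) s (ar_ge2 E) (or_intror a1).
  have [m [mm eta_eps rmax]] := rem_record (alpha_gt0 E) irr (maxn m0 r.+1) eps0.
  move: mm; rewrite geq_max => /andP[m0m rm].
  set eta := alpha E - _ in eta_eps.
  have eta0 : 0 < eta by have := rem_lt (alpha_gt0 E) m; rewrite /eta; lra.
  exists (Num.trunc (s%:R / eta) * m)%N => G C D0 GK CD Cle Dcl /andP[KD Ds].
  have start := reach_start GK CD Cle Dcl.
  have /andP[t0 tD] := residual_bounds GK CD Cle.
  set t := deltaS [set: fdom G] - deltaS C in start t0 tD.
  have te0 : 0 <= t / eta by rewrite divr_ge0 // ltW.
  (* As many gadgets as the excess can pay for leave a remainder below [eta], hence below [eps]. *)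
  have := truncn_itv te0; rewrite ler_pdivlMr // ltr_pdivrMr // -natr1.
  set k := Num.trunc _ => /andP[kt tk].
  have ks : (k <= Num.trunc (s%:R / eta))%N.
    apply: le_truncn; rewrite ler_pM2r ?invr_gt0 //; apply: le_trans tD _.
    by rewrite ler_nat.
  have /reach_end[G' [j [h1 h2 h3 h4 h5]]] : reach C D0 (0 + k * m) #|D0| (t - k%:R * eta).
    apply: (reach_downs (E := E) start rm (ltW eta0) kt) => // T D eD.
    apply: gad => //; rewrite ?eD //; first exact: leq_trans (base_size_ge E) KD.
    exact: leq_ltn_trans rm.
  exists G', j; split=> //; first by rewrite h2 add0n leq_add2l leq_mul2r ks orbT.
  by rewrite h5; lra.
have {rat} rat E : exists iq : nat * nat, (0 < iq.1)%N /\ iq.1%:R = alpha E * iq.2%:R.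
  apply: contrapT => no; apply: rat; exists E => i q i0 eiq; apply: no.
  by exists (i, q).
have [iq iqP] := choice rat; pose q E := (iq E).2.
have q_gt0 E : (0 < q E)%N.
  have [i0 e] := iqP E; rewrite lt0n; apply/eqP => q0; move: e.
  by rewrite -/(q E) q0 mulr0 => /eqP; rewrite pnatr_eq0; case: (iq E).1 i0.
have [E Egood] : exists E, (2 < ar E)%N \/ alpha E < 1.
  apply: contrapT => no; apply: nondegenerate; split=> E; apply: contrapT => h; apply: no; exists E.
    by left; rewrite ltn_neqAle ar_ge2 andbT eq_sym; apply/eqP.
  by right; rewrite lt_neqAle alpha_le1 andbT; apply/eqP.
have [i0 e0] := iqP E.
have [eta [x [eta0 qx rec]]] := rem_record_rational (alpha_gt0 E) i0 e0.
have x_gt0 : (0 < x)%N by rewrite -(ltr_nat R) -qx mulr_gt0 // ltr0n q_gt0.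
pose u0 := (\sum_F q F + x)%N.
have [m0 gad] := gadget_exists (alpha_gt0 E) (alpha_le1 E) (s + u0) (ar_ge2 E) Egood.
have [m [mm etaE rmax]] := rec (maxn m0 r.+1).
move: mm; rewrite geq_max => /andP[m0m rm].
exists (u0 + Num.trunc ((s + u0)%:R / eta) * m)%N => G C D0 GK CD Cle Dcl /andP[KD Ds].
have start := reach_start GK CD Cle Dcl.
have /andP[t0 tD] := residual_bounds GK CD Cle.
set t := deltaS [set: fdom G] - deltaS C in start t0 tD.
pose n F := (Nset F [set: fdom G] - Nset F C)%N.
have tE : t = #|fdom G|%:R - #|C|%:R - \sum_F alpha F * (n F)%:R.
  have -> : \sum_F alpha F * (n F)%:R =
      \sum_F alpha F * (Nset F [set: fdom G])%:R - \sum_F alpha F * (Nset F C)%:R.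
    by rewrite -sumrB; apply: eq_bigr => F _; rewrite natrB ?Nset_mono ?subsetT // mulrBr.
  rewrite /t /Defs.deltaS cardsT; ring.
(* [c F] new points, each on one edge of symbol [F], turn the number of [F]-edges not inside [C]
   into a multiple of [q F], whose weight is an integer. After this for all symbols the excess is a
   natural number [y]. *)
pose c F := (q F - n F %% q F)%N.
have cq F : (c F <= q F)%N by apply: leq_subr.
have nc F : (n F + c F = q F * (n F %/ q F).+1)%N.
  by rewrite /c mulnS mulnC {1}(divn_eq (n F) (q F)) -addnA subnKC ?(ltnW (ltn_pmod _ _)) // addnC.
have ups (l : seq L) : reach C D0 (\sum_(F <- l) c F)%N (#|D0| + \sum_(F <- l) c F)%N
    (t + \sum_(F <- l) (c F)%:R * (1 - alpha F)).
  elim: l => [|F l IH]; first by rewrite !big_nil !addn0 addr0.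
  have := reach_ups true (E := F) (c F) IH; rewrite !big_cons mul1r.
  rewrite (addnC (c F)) addnA (addrC (_ * _)) addrA; apply.
  apply: leq_trans (_ : base_size <= _)%N.
    by rewrite (leq_trans _ (base_size_ge F)) // -addnA leq_addr.
  by rewrite (leq_trans KD) // leqW // leq_addr.
have [y yE] : exists y : nat, t + \sum_F (c F)%:R * (1 - alpha F) = y%:R.
  pose p := (#|fdom G| + \sum_F c F)%N.
  pose p' := (#|C| + \sum_F (iq F).1 * (n F %/ q F).+1)%N.
  have e : t + \sum_F (c F)%:R * (1 - alpha F) = p%:R - p'%:R.
    rewrite tE /p /p' !natrD !natr_sum.
    have -> : \sum_F ((iq F).1 * (n F %/ q F).+1)%:R =
        \sum_F alpha F * (n F)%:R + \sum_F (c F)%:R * alpha F.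
      rewrite -big_split /=; apply: eq_bigr => F _.
      by rewrite natrM (proj2 (iqP F)) -mulrA -natrM -/(q F) -nc natrD; ring.
    under [X in _ + X = _]eq_bigr => F _ do rewrite mulrBr mulr1.
    rewrite sumrB; ring.
  exists (p - p')%N; rewrite natrB // -(ler_nat R) -subr_ge0 -e addr_ge0 //.
  by apply: sumr_ge0 => F _; rewrite mulr_ge0 // subr_ge0.
(* [c0] isolated points bring [y] to a multiple of [x], which is [q E * eta], so a whole number of
   gadgets removes the excess exactly. *)
pose c0 := (x - y %% x)%N.
have yc0 : (y + c0 = x * (y %/ x).+1)%N.
  by rewrite /c0 mulnS mulnC {1}(divn_eq y x) -addnA subnKC ?(ltnW (ltn_pmod _ _)) // addnC.
have sum_c : (\sum_F c F <= \sum_F q F)%N by apply: leq_sum.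
have c0x : (c0 <= x)%N by apply: leq_subr.
have up2 := reach_ups false (E := E) c0 (ups (index_enum L)).
rewrite yE mul0r subr0 mulr1 -natrD in up2.
have {}up2 := up2 (leq_trans (leq_trans (leq_addr _ _) (leq_trans (leq_addr _ _)
  (base_size_ge E))) (leq_trans KD (leqW (leq_addr _ _)))).
pose k := (q E * (y %/ x).+1)%N.
have kE : k%:R * eta = (y + c0)%:R by rewrite yc0 !natrM -qx -/(q E); ring.
have bound : (y + c0)%:R <= (s + u0)%:R :> R.
  have : \sum_F (c F)%:R * (1 - alpha F) <= (\sum_F q F)%:R.
    rewrite natr_sum; apply: ler_sum => F _.
    apply: le_trans (_ : (c F)%:R * 1 <= _); last by rewrite mulr1 ler_nat.
    by rewrite ler_wpM2l // gerBl ltW.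
  have : #|D0|%:R <= s%:R :> R by rewrite ler_nat.
  have : c0%:R <= x%:R :> R by rewrite ler_nat.
  by rewrite /u0 !natrD -yE; lra.
have ks : (k <= Num.trunc ((s + u0)%:R / eta))%N.
  have q0 : 0 <= (s + u0)%:R / eta by rewrite divr_ge0 // ltW.
  by rewrite truncn_ge_nat // ler_pdivlMr // kE.
have dle : (#|D0| + \sum_F c F + c0 <= s + u0)%N by rewrite /u0 -addnA !leq_add.
have /reach_end[G' [j [h1 h2 h3 h4 h5]]] : reach C D0 (0 + \sum_F c F + c0 + k * m)
    (#|D0| + \sum_F c F + c0) ((y + c0)%:R - k%:R * eta).
  apply: (reach_downs (E := E) up2 rm (ltW eta0)); rewrite ?kE // => T D eD.
  apply: gad => //; rewrite ?eD //; last exact: leq_ltn_trans rm.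
  by apply: leq_trans (base_size_ge E) (leq_trans KD _); rewrite -addnA leq_addr.
exists G', j; split=> //.
  by rewrite h2 leq_add2l leq_add // ?leq_add // leq_mul2r ks orbT.
by rewrite h5 kE subrr addr0; lra.
Qed.

End LowerDelta.

(** * Quantifier elimination *)

Section Agreement.
Variables (L : finType) (ar : L -> nat) (R : realType) (alpha : L -> R).
Hypothesis ar_ge2 : forall E, (2 <= ar E)%N.
Hypothesis alpha_gt0 : forall E, 0 < alpha E.
Hypothesis alpha_le1 : forall E, alpha E <= 1.
Implicit Types (A B : finLstr ar) (M N : Lstr ar) (V : seq nat).
Local Notation deltaS := (deltaS alpha).
Local Notation delta := (delta alpha).

Definition agree V (m : nat) M N (rho : nat -> M) (sigma : nat -> N) : Prop :=
  forall (B : finLstr ar) (X : {set fdom B}) (v : fdom B -> nat),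
  inKalpha alpha B -> chain_minimal alpha X -> injective v -> (#|fdom B| <= m)%N ->
  (forall b, b \in X -> v b \in V) -> sat rho (ExtF X v) <-> sat sigma (ExtF X v).

Lemma agree_sym V m M N (rho : nat -> M) (sigma : nat -> N) :
  agree V m rho sigma -> agree V m sigma rho.
Proof. by move=> h B X v h1 h2 h3 h4 h5; split=> /h; apply. Qed.

Lemma agree_sub V V' m m' M N (rho : nat -> M) (sigma : nat -> N) :
  {subset V' <= V} -> (m' <= m)%N -> agree V m rho sigma -> agree V' m' rho sigma.
Proof.
move=> VV mm h B X v h1 h2 h3 h4 h5; apply: h => //; first exact: leq_trans mm.
by move=> b /h5/VV.
Qed.

Lemma extend_injection (T U : finType) (i : T -> U) (w : T -> nat) :
  injective i -> injective w -> exists2 v : U -> nat, injective v & forall t, v (i t) = w t.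
Proof.
move=> i_inj w_inj; pose n := (\max_t w t).+1.
pose v (u : U) := if [pick t | i t == u] is Some t then w t else (n + enum_rank u)%N.
have wn t : (w t < n)%N by rewrite ltnS leq_bigmax.
exists v => [x y|t]; rewrite /v.
  case: pickP => [t /eqP <-|_]; case: pickP => [t' /eqP <-|_] e.
  - by rewrite (w_inj _ _ e).
  - by have := wn t; rewrite e; lia.
  - by have := wn t'; rewrite -e; lia.
  by apply/enum_rank_inj/val_inj/(@addnI n).
by case: pickP => [t' /eqP/i_inj ->//|/(_ t)]; rewrite eqxx.
Qed.

(** If the two values differed in [N], the diagram of the two points there, an extension formula
    with nothing to extend, would hold in [M] as well. *)
Lemma agree_eq V m M N (rho : nat -> M) (sigma : nat -> N) x y :
  model alpha N -> agree V m rho sigma -> (2 <= m)%N -> x \in V -> y \in V ->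
  rho x = rho y -> sigma x = sigma y.
Proof.
move=> Nm ag m2 xV yV exy; apply: contrapT => nxy.
pose v (b : bool) := if b then x else y.
have v_inj : injective v.
  by move=> [] [] //= e; case: nxy; rewrite e.
have f_inj : injective (fun b => sigma (v b)).
  by move=> [] [] //= e; case: nxy; rewrite e.
have fE := emb_induced f_inj.
have VT b : b \in [set: bool] -> v b \in V by case: b.
have := (ag (induced (fun b => sigma (v b))) setT v (Nm.1 _ _ fE) (chain_minimal_refl _ _)
  v_inj _ VT).2.
rewrite card_bool !sat_ExtF // => /(_ m2)[|g [g_inj _] gv]; first by exists (fun b => sigma (v b)).
by have /g_inj : g true = g false by rewrite !gv ?inE.
Qed.

(** Extension formulas force distinct variables to have distinct values, so each value of [rho] on
    [V] is named by the least variable taking it. By [agree_eq] these names serve [sigma] too, and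
    the trivial chain transfers the diagram. *)
Lemma agree_representatives V m M N (rho : nat -> M) (sigma : nat -> N) :
  model alpha M -> model alpha N -> agree V m rho sigma ->
  (2 <= m)%N -> (size V <= m)%N ->
  exists (A : finLstr ar) (w : fdom A -> nat),
  [/\ injective w /\ (forall a, w a \in V), (#|fdom A| <= size V)%N,
      emb (M := M) (fun a => rho (w a)), emb (M := N) (fun a => sigma (w a)) &
      forall x, x \in V -> exists a, rho (w a) = rho x /\ sigma (w a) = sigma x].
Proof.
move=> Mm Nm ag m2 Vm.
pose least (x : seq_sub V) := `[< forall y, y \in V -> rho y = rho (val x) -> (val x <= y)%N >].
pose T : finType := {x | least x}; pose w (t : T) := val (val t).
have w_inj : injective w by move=> s t /val_inj/val_inj.
have wV t : w t \in V by apply: valP.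
have f_inj : injective (fun t => rho (w t)).
  move=> s t e; apply/w_inj/anti_leq; have /asboolP hs := valP s; have /asboolP ht := valP t.
  by rewrite hs ?ht.
have fE := emb_induced f_inj.
have cT : (#|T| <= size V)%N.
  rewrite cardE -(size_map w); apply: uniq_leq_size; first by rewrite map_inj_uniq ?enum_uniq.
  by move=> _ /mapP[t _ ->].
exists (induced (fun t => rho (w t))), w; split=> //.
  have := (ag (induced (fun t => rho (w t))) setT w (Mm.1 _ _ fE) (chain_minimal_refl _ _)
    w_inj (leq_trans cT Vm) (fun t _ => wV t)).1.
  rewrite !sat_ExtF // => -[|g gE gw]; first by exists (fun t => rho (w t)).
  by have -> : (fun t => sigma (w t)) = g by apply/funext => t; rewrite gw.
move=> x xV; have ex : exists y, (y \in V) && `[< rho y = rho x >].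
  by exists x; rewrite xV; apply/asboolP.
case: (ex_minnP ex) => y /andP[yV /asboolP eyx] ymin.
have ly : least (SeqSub yV).
  apply/asboolP => z zV /= ez; apply: ymin; rewrite zV; apply/asboolP.
  by rewrite ez.
exists (exist _ (SeqSub yV) ly); rewrite /w /=; split=> //.
exact: agree_eq Nm ag m2 yV xV eyx.
Qed.

Lemma agree_extensions V m M N (rho : nat -> M) (sigma : nat -> N) A (w : fdom A -> nat)
    B (i : fdom A -> fdom B) :
  agree V m rho sigma -> injective w -> (forall a, w a \in V) ->
  emb (M := toL B) i -> inKalpha alpha B -> chain_minimal alpha (i @: setT) ->
  (#|fdom B| <= m)%N ->
  (exists2 g : fdom B -> M, emb g & forall a, g (i a) = rho (w a)) <->
  (exists2 g : fdom B -> N, emb g & forall a, g (i a) = sigma (w a)).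
Proof.
move=> ag w_inj wV [i_inj _] BK Bch Bm.
have [v v_inj vi] := extend_injection i_inj w_inj.
have := ag B (i @: setT) v BK Bch v_inj Bm; rewrite !sat_ExtF //.
have half (K : Lstr ar) (tau : nat -> K) :
    (exists2 g : fdom B -> K, emb (M := K) g & forall b, b \in i @: setT -> g b = tau (v b)) <->
    (exists2 g : fdom B -> K, emb (M := K) g & forall a, g (i a) = tau (w a)).
  split=> -[g gE h]; exists g => // a; first by rewrite h ?vi ?imset_f.
  by case/imsetP => c _ ->; rewrite h vi.
rewrite !half; apply=> b /imsetP[a _ ->]; by rewrite vi.
Qed.

Lemma agree_of_closed V m M N (rho : nat -> M) (sigma : nat -> N)
    D (f : fdom D -> M) (f' : fdom D -> N) :
  emb f -> emb f' -> rclosed alpha m f -> rclosed alpha m f' ->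
  (forall x, x \in V -> exists d, f d = rho x /\ f' d = sigma x) ->
  agree V m rho sigma.
Proof.
move=> fE f'E fm f'm cov B X v BK Bch v_inj Bm XV; rewrite !sat_ExtF //.
have half (K K' : Lstr ar) (h : fdom D -> K) (h' : fdom D -> K') tau tau' :
    emb h -> emb h' -> rclosed alpha m h ->
    (forall x, x \in V -> exists d, h d = tau x /\ h' d = tau' x) ->
    (exists2 g : fdom B -> K, emb g & forall b, b \in X -> g b = tau (v b)) ->
    (exists2 g : fdom B -> K', emb g & forall b, b \in X -> g b = tau' (v b)).
  move=> hE h'E hm hcov [g gE gX].
  have gD : forall b, exists d, h d = g b.
    apply: (chain_in_closed alpha_gt0 hE gE hm Bm Bch) => b bX.
    by have [d [hd _]] := hcov _ (XV b bX); exists d; rewrite hd gX.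
  have [k kP] := choice gD.
  have kE : emb (M := toL D) k by apply: emb_factor kP hE gE.
  exists (fun b => h' (k b)); first exact: emb_comp kE h'E.
  move=> b bX; have [d [hd <-]] := hcov _ (XV b bX); congr h'.
  by apply: (proj1 hE); rewrite kP gX.
split; first exact: half fE f'E fm cov.
by apply: half f'E fE f'm _ => x /cov[d [? ?]]; exists d.
Qed.

Definition edgeless (T : finType) : finLstr ar :=
  FinLstr (fun E (_ : {ffun 'I_(ar E) -> T}) => false).

Lemma edgeless_deltaS (T : finType) (X : {set fdom (edgeless T)}) : deltaS X = #|X|%:R.
Proof.
rewrite /Defs.deltaS big1 ?subr0 // => E _.
rewrite [Nset _ _]eq_card0 ?mulr0 // => S; rewrite !inE.
by apply/negP => /andP[_ /existsP[a /andP[]]].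
Qed.

Lemma edgeless_inKalpha (T : finType) : inKalpha alpha (edgeless T).
Proof. by split=> // X; rewrite edgeless_deltaS ler0n. Qed.

(** The empty structure is strong in an edgeless one, so the extension axiom applies to it. The
    points serve to pad [D] to the size gadgets require. *)
Lemma model_infinite M k : model alpha M -> exists f : 'I_k -> M, injective f.
Proof.
move=> Mm; pose i (x : 'I_0) : 'I_k := match x with Ordinal _ p => False_rect _ (notF p) end.
have noE (E : L) (T : Type) (g : 'I_(ar E) -> 'I_0) : False.
  have E0 : (0 < ar E)%N by apply: leq_trans (ar_ge2 E).
  by case: (g (Ordinal E0)).
have [] := Mm.2 (edgeless 'I_0) (edgeless 'I_k) i _ (edgeless_inKalpha _) (edgeless_inKalpha _) _
  (fun x : 'I_0 => match x with Ordinal _ p => False_rect _ (notF p) end).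
- split=> [[]//|E a]; by case: (noE E unit a).
- apply/forallP => Z; apply/implyP => _; rewrite !edgeless_deltaS ler_nat.
  rewrite (_ : [set i a | a in _] = set0) ?cards0 //.
  by apply/setP => x; rewrite inE; apply/imsetP => -[[]].
- split=> [[]//|E a]; by case: (noE E unit a).
by move=> g [[g_inj _] _]; exists g.
Qed.

Lemma joint_card A B M (f : fdom A -> M) (g : fdom B -> M) : emb f -> emb g ->
  exists (U : finLstr ar) (u : fdom U -> M) (i : fdom A -> fdom U) (j : fdom B -> fdom U),
  [/\ emb u, (forall a, u (i a) = f a), (forall b, u (j b) = g b),
      i @: setT :|: j @: setT = setT & (#|fdom U| <= #|fdom A| + #|fdom B|)%N].
Proof.
move=> fE gE; have [U [u [i [j [h1 h2 h3 h4]]]]] := joint fE gE.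
exists U, u, i, j; split=> //; rewrite -cardsT -h4.
apply: leq_trans (_ : #|i @: setT| + #|j @: setT| <= _)%N.
  by rewrite -cardsUI leq_addr.
by rewrite leq_add // (leq_trans (leq_imset_card _ _)) // max_card.
Qed.

Hypothesis nondegenerate : ~ ((forall E, ar E = 2%N) /\ (forall E, alpha E = 1)).

(* A small extension of the image of [D] with smaller delta would lower the delta
   of the image of [G], which exceeds [delta C] by less than [eps], below [delta C]. *)
Lemma tight_closed r r' eps G N (h : fdom G -> N) D C
    (j : fdom D -> fdom G) (k : fdom C -> fdom G) :
  (forall (A : finLstr ar) (X Y : {set fdom A}), X \subset Y -> (#|Y| <= #|X| + r)%N ->
     deltaS Y < deltaS X -> deltaS Y <= deltaS X - eps) ->
  emb h -> emb (M := toL G) j -> emb (M := toL G) k ->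
  rclosed alpha r' (fun c => h (k c)) -> (#|fdom G| + r <= #|fdom C| + r')%N ->
  (forall Z : {set fdom G}, j @: setT \subset Z -> (#|Z| <= #|fdom D| + r)%N ->
     deltaS (j @: setT) <= deltaS Z) ->
  deltaS [set: fdom G] < delta C + eps ->
  rclosed alpha r (fun d => h (j d)).
Proof.
move=> gap hE jE kE kcl size jcl tight U u i uE ui Ur; rewrite leNgt; apply/negP => lt.
have jhE := emb_comp jE hE.
have iE : emb (M := toL U) i by apply: emb_factor ui uE jhE.
have [W [w [p [q [wE wp wq _]]]]] := joint hE uE.
have pE : emb (M := toL W) p by apply: emb_factor wp wE hE.
have qE : emb (M := toL W) q by apply: emb_factor wq wE uE.
have [w_inj _] := wE.
have pq d : p (j d) = q (i d) by apply: w_inj; rewrite wp wq ui.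
have ij : q @: (i @: setT) = p @: (j @: setT).
  by rewrite -!imset_comp; apply: eq_imset => d; rewrite /= pq.
have di : deltaS (i @: setT) = delta D by rewrite deltaS_emb.
have dj : deltaS (j @: setT) = delta D by rewrite deltaS_emb.
have ci : #|i @: setT| = #|fdom D| by rewrite card_imset ?cardsT //; case: iE.
have := gap _ _ _ (subsetT (i @: setT)); rewrite cardsT ci di => /(_ Ur lt) dU.
pose P := p @: setT; pose Q := q @: setT.
have DPQ : q @: (i @: setT) \subset P :&: Q.
  by rewrite subsetI {1}ij !imsetS ?subsetT.
have [Z0 _ eZ0] := subset_imsetP (subsetIl P Q).
have dPQ : delta D <= deltaS (P :&: Q).
  rewrite eZ0 (deltaS_emb _ _ pE) -dj; apply: jcl.
    by rewrite -(inj_imsetS _ _ (proj1 pE)) -eZ0 -ij.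
  rewrite -(card_imset _ (proj1 pE)) -eZ0.
  apply: leq_trans (subset_leq_card (subsetIr P Q)) _.
  by rewrite /Q card_imset ?cardsT //; case: qE.
have cDPQ : (#|fdom D| <= #|P :&: Q|)%N.
  rewrite -ci -(card_imset _ (proj1 qE)); exact: subset_leq_card.
have cP : #|P| = #|fdom G| by rewrite card_imset ?cardsT //; case: pE.
have cQ : #|Q| = #|fdom U| by rewrite card_imset ?cardsT //; case: qE.
have := deltaS_submod alpha_gt0 P Q.
rewrite (deltaS_emb _ _ pE) (deltaS_emb _ _ qE).
have : delta C <= deltaS (P :|: Q).
  apply: (rclosed_sub (i := fun c => p (k c)) kcl wE); first by move=> c; rewrite wp.
    rewrite (_ : imset _ _ = p @: (k @: setT)); last by rewrite -imset_comp.
    by apply: subset_trans (subsetUl _ _); rewrite imsetS ?subsetT.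
  (* The images of [G] and [U] share at least the image of [D], so their union has at most [r]
     points more than [G]. *)
  apply: leq_trans size; rewrite -(leq_add2r #|P :&: Q|) cardsUI cP cQ -addnA leq_add2l.
  by apply: leq_trans Ur _; rewrite addnC leq_add2l.
move: tight dU dPQ; rewrite -/(delta U); lra.
Qed.

(* The witness is moved together with its [m1]-closure [D], whose size does not depend
   on the much more closed set [C]: over [C] one only needs the tight extension of
   [C :|: D], and the number of points added to it depends on [D] alone. *)
Lemma back_and_forth V i m1 : exists m, forall M N (rho : nat -> M) (sigma : nat -> N),
  model alpha M -> model alpha N -> agree [seq k <- V | k != i] m rho sigma ->
  forall c : M, exists d : N, agree V m1 (fun k => if k == i then c else rho k)
                                     (fun k => if k == i then d else sigma k).
Proof.
set V0 := [seq k <- V | k != i].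
pose K := base_size ar alpha; pose n := size V0.
have [eps eps0 gap] := delta_gap ar alpha_gt0 m1.
have [b1 b1mono clos1] := common_closure ar alpha_gt0 m1.
(* Bounds [D], the closure of at most [n] parameters, the point [c] and [K] padding points. *)
pose s := b1 (n + 1 + K)%N.
have [e low] := lower_delta ar_ge2 alpha_gt0 alpha_le1 m1 nondegenerate s eps0.
(* What [C] must withstand: the points of [D], the gadget points, and [m1] points that might spoil
   the closedness of [D] in [N]. *)
pose r := (s + e + m1)%N.
have [b2 b2mono clos2] := common_closure ar alpha_gt0 r.
exists (maxn (b2 n) (maxn n 2)) => M N rho sigma Mm Nm ag c.
set m := maxn _ _ in ag.
have [bm nm m2] : [/\ (b2 n <= m)%N, (n <= m)%N & (2 <= m)%N].
  by rewrite /m !leq_max !leqnn !orbT.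
have [A [w [[w_inj wV] Asz fE f'E cov]]] := agree_representatives Mm Nm ag m2 nm.
have [C [iC [g [g' [[gE g'E] gi g'i [gr g'r] _]]]]] := clos2 M N A _ _ m Mm Nm fE f'E
  (leq_trans (b2mono _ _ Asz) bm) (fun B j => agree_extensions ag w_inj wV).
have pt_inj : injective (fun _ : unit => c) by move=> [] [].
have [U1 [u1 [i1 [j1 [u1E u1i u1j _ U1sz]]]]] := joint_card fE (emb_induced pt_inj).
have [pts pts_inj] := model_infinite K Mm.
have [U2 [u2 [i2 [j2 [u2E u2i u2j _ U2sz]]]]] := joint_card u1E (emb_induced pts_inj).
rewrite card_ord in U2sz; rewrite card_unit in U1sz.
have U2s : (#|fdom U2| <= n + 1 + K)%N.
  by apply: leq_trans U2sz _; rewrite leq_add2r (leq_trans U1sz) // leq_add2r.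
have KU2 : (K <= #|fdom U2|)%N.
  rewrite -(card_ord K) -(card_codom (f := j2)); first exact: max_card.
  by move=> x y e'; apply: pts_inj; rewrite -!u2j e'.
(* With [M] in both roles the transfer hypothesis is trivial, and the common closure is an ordinary
   closure of bounded size. *)
have [D [iD [gD [_ [[gDE _] gDi _ [gDr _] Dsz]]]]] := clos1 M M U2 u2 u2 _ Mm Mm u2E u2E
  (leqnn _) (fun _ _ _ _ _ _ => iff_refl _).
have Ds : (#|fdom D| <= s)%N by apply: leq_trans Dsz (b1mono _ _ U2s).
have iDE : emb (M := toL D) iD by apply: emb_factor gDi gDE u2E.
have KD : (K <= #|fdom D|)%N.
  by apply: leq_trans KU2 _; rewrite -(card_codom (proj1 iDE)); apply: max_card.
have [U [u [k [j [uE uk uj kj Usz]]]]] := joint_card gE gDE.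
have kE : emb (M := toL U) k by apply: emb_factor uk uE gE.
have jE : emb (M := toL U) j by apply: emb_factor uj uE gDE.
have cj : #|j @: setT| = #|fdom D| by rewrite card_imset ?cardsT //; case: jE.
have [|||G [q [[qE GK] Gsz Gle Gcl Gtight]]] := low U (k @: setT) (j @: setT) (Mm.1 _ _ uE) kj.
- move=> Z kZ; rewrite (deltaS_emb _ _ kE); apply: (rclosed_sub gr uE uk kZ).
  apply: leq_trans (max_card _) (leq_trans Usz _); rewrite leq_add2l.
  by apply: leq_trans Ds _; rewrite /r -addnA leq_addr.
- move=> Z jZ; rewrite cj (deltaS_emb _ _ jE); exact: (rclosed_sub gDr uE uj jZ).
- by rewrite cj KD.
have qkE : emb (M := toL G) (fun x => q (k x)) by apply: (emb_comp (M := toL G) kE qE).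
have qjE : emb (M := toL G) (fun x => q (j x)) by apply: (emb_comp (M := toL G) jE qE).
have qk : [set q (k a) | a in setT] = q @: (k @: setT) by rewrite -imset_comp.
have qj : [set q (j a) | a in setT] = q @: (j @: setT) by rewrite -imset_comp.
have [|h [hE hk]] := Nm.2 C G (fun x => q (k x)) qkE (Mm.1 _ _ gE) GK _ g' g'E.
  have -> : [set q (k a) | a : fdom C] = q @: (k @: setT).
    rewrite -qk; by apply/setP => x; apply/imsetP/imsetP => -[a _ ->]; exists a.
  by apply/forallP => Z; apply/implyP => /andP[+ _]; apply: Gle.
have hr : rclosed alpha m1 (fun d => h (q (j d))).
  apply: (tight_closed (r' := r) (k := fun x => q (k x)) gap hE qjE qkE).
  - by have -> : (fun x => h (q (k x))) = g' by apply/funext.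
  - rewrite /r !addnA leq_add2r (leq_trans Gsz) // leq_add2r.
    by apply: leq_trans Usz _; rewrite leq_add2l.
  - by move=> Z; rewrite qj -cj; apply: Gcl.
  - by move: Gtight; rewrite (deltaS_emb _ _ qE) (deltaS_emb _ _ kE).
pose c0 : fdom D := iD (i2 (j1 tt)).
have c0E : gD c0 = c by rewrite gDi u2i u1j.
exists (h (q (j c0))); apply: (agree_of_closed gDE (emb_comp qjE hE) gDr hr) => x xV.
have [xi|xi] := eqVneq x i; first by exists c0.
have [|a [ra sa]] := cov x; first by rewrite mem_filter xi.
exists (iD (i2 (i1 a))); split; first by rewrite gDi u2i u1i.
have -> : j (iD (i2 (i1 a))) = k (iC a).
  by apply: (proj1 uE); rewrite uj uk gDi u2i u1i gi.
by rewrite hk g'i.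
Qed.

(** The bound [m] depends on the formula alone and not on the models; this uniformity is what makes
    finitely many extension formulas decide [phi]. *)
Lemma sat_agree phi : exists m, forall M N (rho : nat -> M) (sigma : nat -> N),
  model alpha M -> model alpha N -> agree (fv phi) m rho sigma ->
  sat rho phi <-> sat sigma phi.
Proof.
elim: phi => [|E w|i j|f [m IH]|f [mf IHf] g [mg IHg]|i f [m1 IH]] /=.
- by exists 0%N.
- set V := [seq w k | k <- _]; exists (maxn (size V) 2) => M N rho sigma Mm Nm ag.
  have wV k : w k \in V by rewrite map_f // mem_enum.
  have [A [v [_ _ [_ fE] [_ f'E] cov]]] :=
    agree_representatives Mm Nm ag (leq_maxr _ _) (leq_maxl _ _).
  have [a aP] := choice (fun k => cov _ (wV k)).
  pose a' : {ffun 'I_(ar E) -> fdom A} := [ffun k => a k].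
  have eM : (fun k => rho (v (a' k))) = (fun k => rho (w k)).
    by apply/funext => k; rewrite ffunE (proj1 (aP k)).
  have eN : (fun k => sigma (v (a' k))) = (fun k => sigma (w k)).
    by apply/funext => k; rewrite ffunE (proj2 (aP k)).
  by rewrite -eM -eN; have := fE E a'; have := f'E E a'; tauto.
- exists 2%N => M N rho sigma Mm Nm ag; have iV : i \in [:: i; j] by rewrite inE eqxx.
  have jV : j \in [:: i; j] by rewrite !inE eqxx orbT.
  by split; [apply: agree_eq Nm ag _ iV jV | apply: agree_eq Mm (agree_sym ag) _ iV jV].
- by exists m => M N rho sigma Mm Nm ag; rewrite (IH M N rho sigma).
- exists (maxn mf mg) => M N rho sigma Mm Nm ag.
  rewrite (IHf M N rho sigma) ?(IHg M N rho sigma) //.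
    by apply: agree_sub (leq_maxr _ _) ag => k; rewrite mem_cat => ->; rewrite orbT.
  by apply: agree_sub (leq_maxl _ _) ag => k; rewrite mem_cat => ->.
have [m bf] := back_and_forth (fv f) i m1; exists m => M N rho sigma Mm Nm ag.
split=> [[c cP]|[d dP]].
  by have [d /IH h] := bf M N rho sigma Mm Nm ag c; exists d; apply/h.
by have [c /IH h] := bf N M sigma rho Nm Mm (agree_sym ag) d; exists c; apply/h.
Qed.

End Agreement.

(** * From agreement on finitely many formulas to one Boolean combination *)

Section Definability.
Variables (L : finType) (ar : L -> nat) (R : realType) (alpha : L -> R).
Hypothesis ar_ge2 : forall E, (2 <= ar E)%N.
Implicit Types (A B : finLstr ar) (M N : Lstr ar) (V : seq nat).

Lemma ExtF_iso A B (e : fdom A -> fdom B) (e' : fdom B -> fdom A) (X : {set fdom B})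
    (v : fdom B -> nat) (v' : fdom A -> nat) M (rho : nat -> M) :
  emb (M := toL B) e -> cancel e e' -> cancel e' e -> injective v -> injective v' ->
  (forall a, e a \in X -> v' a = v (e a)) ->
  sat rho (ExtF (e @^-1: X) v') <-> sat rho (ExtF X v).
Proof.
move=> eE eK e'K v_inj v'_inj ev; rewrite !sat_ExtF //; split=> -[g gE gX].
  exists (fun b => g (e' b)).
    apply: (emb_comp (i := e') _ gE).
    by apply: (emb_factor (M := toL B) e'K eE (emb_id B)).
  by move=> b bX; rewrite gX ?inE ?e'K // ev ?e'K.
exists (fun a => g (e a)); first exact: emb_comp eE gE.
by move=> a; rewrite inE => aX; rewrite gX // ev.
Qed.

Lemma inKalpha_emb A B (e : fdom A -> fdom B) :
  emb (M := toL B) e -> inKalpha alpha B -> inKalpha alpha A.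
Proof.
move=> eE [BK B0]; split=> [E a|X]; last by rewrite -(deltaS_emb _ _ eE).
have [e_inj ea] := proj1 (emb_toLP _) eE; rewrite ea => /BK[h1 h2]; split.
  by move=> k l kl; apply: h1; rewrite !ffunE kl.
move=> p /h2; rewrite ea; congr is_true; congr Defs.frel.
by apply/ffunP => k; rewrite !ffunE.
Qed.

(** [boolcomb] has no constant, so truth is expressed by the extension formula of the empty
    structure. *)
Definition trueF : Defs.form ar := ExtF (B := edgeless ar void) setT (@of_void nat).

Lemma sat_trueF M (rho : nat -> M) : sat rho trueF.
Proof.
apply/sat_ExtF; first by case.
exists (@of_void M) => [|[]]; split=> [[]//|E a].
have E0 : (0 < ar E)%N by apply: leq_trans (ar_ge2 E).
by case: (a (Ordinal E0)).
Qed.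

Lemma boolcomb_trueF : boolcomb alpha trueF.
Proof.
by apply: bc_ext; [apply: edgeless_inKalpha | apply: chain_minimal_refl | case].
Qed.

Lemma fv_trueF : fv trueF =i [::].
Proof. by move=> k; rewrite in_nil; apply/negP => /fv_ExtF[[]]. Qed.

Section FiniteIndex.
Variables (V : seq nat) (m : nat).
Let bound := ((\max_(x <- V) x).+1 + m)%N.

(* Up to equivalence, the extension formulas with at most [m] elements and parameters
   in [V] are those of structures on ['I_k] with variables below [bound]. *)
Definition code (k : nat) : Type :=
  ({dffun forall E : L, {ffun {ffun 'I_(ar E) -> 'I_k} -> bool}} *
  {set 'I_k} * {ffun 'I_k -> 'I_bound})%type.
HB.instance Definition _ k := Finite.on (code k).

Definition code_str k (c : code k) : finLstr ar := FinLstr (fun E a => c.1.1 E a).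

Definition code_ok k (c : code k) : Prop :=
  [/\ inKalpha alpha (code_str c), chain_minimal alpha (B := code_str c) c.1.2,
      injective c.2 & forall b, b \in c.1.2 -> (c.2 b : nat) \in V].

Definition codes : finType := {k : 'I_m.+1 & code k}.

(** Codes that do not describe an admissible formula are sent to [trueF], so the whole finite type
    can serve as index. *)
Definition code_form (x : codes) : Defs.form ar :=
  if `[< code_ok (tagged x) >] then
    ExtF (B := code_str (tagged x)) (tagged x).1.2 (fun b => (tagged x).2 b)
  else trueF.

Lemma boolcomb_code x : boolcomb alpha (code_form x).
Proof.
rewrite /code_form; case: asboolP => [[h1 h2 h3 _]|_]; last exact: boolcomb_trueF.
by apply: bc_ext => // b c /val_inj/h3.
Qed.

Lemma fv_code x : {subset fv (code_form x) <= V}.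
Proof.
rewrite /code_form; case: asboolP => [[_ _ _ h]|_] k; last by rewrite fv_trueF.
by case/fv_ExtF => b /h bV ->.
Qed.

Lemma agree_codes M N (rho : nat -> M) (sigma : nat -> N) :
  (forall x, sat rho (code_form x) <-> sat sigma (code_form x)) -> agree alpha V m rho sigma.
Proof.
move=> same B X v BK Bch v_inj Bm XV.
pose k := #|fdom B|; pose e : 'I_k -> fdom B := enum_val; pose e' : fdom B -> 'I_k := enum_rank.
have eK : cancel e e' := @enum_valK _; have e'K : cancel e' e := @enum_rankK _.
(* Parameters keep their variables; the quantified ones are renamed beyond all of [V]. *)
pose val' (l : 'I_k) : nat := if e l \in X then v (e l) else ((\max_(x <- V) x).+1 + l)%N.
have Vmax x : x \in V -> (x <= \max_(x <- V) x)%N.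
  by move=> xV; apply: leq_bigmax_seq.
have val'_lt l : (val' l < bound)%N.
  rewrite /val' /bound; case: ifP => [/XV/Vmax h|_]; first by rewrite ltn_addr.
  by rewrite ltn_add2l (leq_trans (ltn_ord l)).
have val'_inj : injective val'.
  move=> l l'; rewrite /val'; case: ifP => [/XV/Vmax h|_]; case: ifP => [/XV/Vmax h'|_].
  - by move=> /v_inj/(can_inj eK).
  - by move=> q; move: h; rewrite q; lia.
  - by move=> q; move: h'; rewrite -q; lia.
  by move=> /addnI/val_inj.
pose c : code k :=
  ([ffun E => [ffun a : {ffun 'I_(ar E) -> 'I_k} => @Defs.frel _ _ B E [ffun l => e (a l)]]],
  e @^-1: X, [ffun l => Ordinal (val'_lt l)]).
have eE : emb (A := code_str c) (M := toL B) e.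
  apply/emb_toLP; split; first exact: can_inj eK.
  by move=> E a; rewrite /= !ffunE.
have e'E : emb (M := toL (code_str c)) (e' : fdom B -> fdom (code_str c)).
  exact: (emb_factor (M := toL B) e'K eE (emb_id B)).
have km : (k < m.+1)%N by [].
have c_ok : code_ok c.
  split.
  - exact: inKalpha_emb eE BK.
  - have <- : e' @: X = c.1.2.
      apply/setP => l; rewrite inE; apply/imsetP/idP => [[b bX ->]|lX]; first by rewrite e'K.
      by exists (e l); rewrite ?eK.
    apply: (chain_minimal_emb e'E) Bch; apply/setP => l; rewrite inE.
    by apply/imsetP; exists (e l); rewrite ?eK.
  - by move=> l l'; rewrite !ffunE => -[/val'_inj].
  by move=> b; rewrite inE ffunE /= /val' => bX; rewrite bX XV.
have cv l : (c.2 l : nat) = val' l by rewrite ffunE.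
have c_inj : injective (fun b => c.2 b : nat) by move=> l l'; rewrite !cv => /val'_inj.
have iso (K : Lstr ar) (tau : nat -> K) :
    sat tau (ExtF (B := code_str c) c.1.2 (fun b => c.2 b)) <-> sat tau (ExtF X v).
  by apply: (ExtF_iso tau eE eK e'K v_inj c_inj) => a aX; rewrite cv /val' aX.
have := same (Tagged (fun k : 'I_m.+1 => code k) (i := Ordinal km) c).
by rewrite /code_form asboolT // !iso.
Qed.

End FiniteIndex.

(** Case distinction on the truth of [theta x]. [Q b] is the hull, under agreement on the shorter
    list, of the part of [P] where [theta x] has truth value [b]. It is invariant by construction,
    hence definable by induction, and it coincides with [P] wherever [theta x] has that value. *)
Lemma boolean_definable (I : eqType) (theta : I -> Defs.form ar) V (s : seq I) :
  (forall x, boolcomb alpha (theta x)) -> (forall x, {subset fv (theta x) <= V}) ->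
  forall P : (forall M : Lstr ar, (nat -> M) -> Prop),
  (forall M N (rho : nat -> M) (sigma : nat -> N), model alpha M -> model alpha N ->
    (forall x, x \in s -> sat rho (theta x) <-> sat sigma (theta x)) ->
    P M rho -> P N sigma) ->
  exists psi, [/\ boolcomb alpha psi, {subset fv psi <= V} &
    forall M (rho : nat -> M), model alpha M -> P M rho <-> sat rho psi].
Proof.
move=> th_bc th_fv; elim: s => [|x s IH] P inv.
  have [[M [rho [Mm PM]]]|no] := pselect (exists M (rho : nat -> M), model alpha M /\ P M rho).
    exists trueF; split=> [||N sigma Nm]; first exact: boolcomb_trueF.
      by move=> k; rewrite fv_trueF.
    by split=> _; [apply: sat_trueF | apply: inv PM].
  exists (FNot trueF); split=> [||N sigma Nm]; first exact/bc_not/boolcomb_trueF.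
    by move=> k; rewrite [fv _]/= fv_trueF.
  split=> [PN|/(_ (sat_trueF sigma))//]; by case: no; exists N, sigma.
pose Q (b : Prop) M (rho : nat -> M) := exists N (sigma : nat -> N),
  [/\ model alpha N, (sat sigma (theta x) <-> b), P N sigma &
   forall y, y \in s -> sat rho (theta y) <-> sat sigma (theta y)].
have Qinv b M N (rho : nat -> M) (sigma : nat -> N) : model alpha M -> model alpha N ->
    (forall y, y \in s -> sat rho (theta y) <-> sat sigma (theta y)) ->
    Q b M rho -> Q b N sigma.
  move=> _ _ h [K [tau [Km Kx PK Kh]]]; exists K, tau; split=> // y ys.
  by rewrite -h // Kh.
have [psi1 [bc1 fv1 h1]] := IH _ (Qinv True).
have [psi2 [bc2 fv2 h2]] := IH _ (Qinv False).
exists (FNot (FAnd (FNot (FAnd (theta x) psi1)) (FNot (FAnd (FNot (theta x)) psi2)))).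
split=> [||M rho Mm].
- by do ![apply: bc_not | apply: bc_and | exact: th_bc | done].
- by move=> k /=; rewrite !mem_cat => /orP[/orP[/th_fv|/fv1]|/orP[/th_fv|/fv2]].
have key b : (sat rho (theta x) <-> b) -> P M rho <-> Q b M rho.
  move=> hb; split=> [PM|[N [sigma [Nm Nx PN Nh]]]]; first by exists M, rho.
  apply: inv PN => // y; rewrite inE => /orP[/eqP ->|ys]; last by rewrite Nh.
  by rewrite Nx hb.
rewrite /= -(h1 M rho Mm) -(h2 M rho Mm).
have [sx|nsx] := pselect (sat rho (theta x)).
  by rewrite (key True) //; have [?|?] := pselect (Q True M rho); tauto.
by rewrite (key False) //; have [?|?] := pselect (Q False M rho); tauto.
Qed.

End Definability.

Theorem theorem4p9 (L : finType) (ar : L -> nat) (R : realType) (alpha : L -> R) :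
  (forall E : L, (2 <= ar E)%N) ->
  (forall E : L, 0 < alpha E <= 1) ->
  ~ ((forall E : L, ar E = 2%N) /\ (forall E : L, alpha E = 1)) ->
  forall phi : Defs.form ar,
  exists psi : Defs.form ar,
    boolcomb alpha psi /\ {subset fv psi <= fv phi} /\
    forall (M : Lstr ar) (rho : nat -> car M),
      model alpha M -> (sat rho phi <-> sat rho psi).
Proof.
move=> ar_ge2 alphaP nondegenerate phi.
have alpha_gt0 E : 0 < alpha E by case/andP: (alphaP E).
have alpha_le1 E : alpha E <= 1 by case/andP: (alphaP E).
have [m mP] := sat_agree ar_ge2 alpha_gt0 alpha_le1 nondegenerate phi.
have inv (M N : Lstr ar) (rho : nat -> M) (sigma : nat -> N) : model alpha M -> model alpha N ->
    (forall x, x \in enum (codes ar (fv phi) m) ->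
       sat rho (code_form alpha x) <-> sat sigma (code_form alpha x)) ->
    sat rho phi -> sat sigma phi.
  move=> Mm Nm same; apply: (mP M N rho sigma Mm Nm _).1; apply: agree_codes => x.
  by apply: same; rewrite mem_enum.
have [psi [h1 h2 h3]] := boolean_definable ar_ge2 (boolcomb_code alpha (V := fv phi) (m := m))
  (fun x => @fv_code _ _ _ _ _ _ x) (P := fun M rho => sat rho phi) inv.
by exists psi.
Qed.
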